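(* Let $\alpha\in(0,1)$, $\mu,r>0$, $h\ge1$, and $\widetilde{q}_h=\dfrac{r}{r+(1-\alpha^h)\mu}$. Let $\{X_t\}$ be a stationary INAR(1) process driven by the thinning operator $(\alpha,\mu,r)\star(\cdot)$ with a $NB(r,\mu)$ marginal distribution and a $NB(r,(1-\alpha)\mu)$ innovation distribution. Then: (i) The conditional pgf of $X_{t+h}$ given $X_t$ is $$\Psi_{X_{t+h}|X_t}(s)=\left(1-\alpha^h\widetilde{q}_h\frac{1-s}{1-(1-\widetilde{q}_h)s}\right)^{X_t}\left(\frac{\widetilde{q}_h}{1-(1-\widetilde{q}_h)s}\right)^r.$$ (ii) $E(X_{t+h}|X_t)=\alpha^hX_t+\mu(1-\alpha^h)$. (iii) $Var(X_{t+h}|X_t)=(2\mu r^{-1}+1)\alpha^h(1-\alpha^h)X_t+\mu(1-\alpha^h)\big(1+(1-\alpha^h)\mu r^{-1}\big)$. (iv) For $i,j\ge0$, the transition probability $\widetilde{p}_{ij}^{(h)}=P(X_{t+h}=j\mid X_t=i)$ is $$\widetilde{p}_{ij}^{(h)}=\begin{cases}B_r^{(j+r)}(\widetilde{q}_h) & \text{if } i=0,\\[4pt]\displaystyle A_0^{(i)}(\alpha^h\widetilde{q}_h)B_r^{(j+r)}(\widetilde{q}_h)+\sum_{k=1}^{j}B_r^{(j-k+r)}(\widetilde{q}_h)\sum_{l=1}^{\min(i,k)}A_l^{(i)}(\alpha^h\widetilde{q}_h)B_l^{(k)}(\widetilde{q}_h) & \text{if } i\ge1.\end{cases}$$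
   Context: $\mathbb{Z}_+=\{0,1,2,\dots\}$; pgf means probability generating function. For $r,m>0$, $NB(r,m)$ is the distribution on $\mathbb{Z}_+$ with pgf $(1+m r^{-1}(1-s))^{-r}$ (its mean is $m$). The thinning operator $(\alpha,\mu,r)\star(\cdot)$ acts on a $\mathbb{Z}_+$-valued random variable $X$ by $(\alpha,\mu,r)\star X=\sum_{i=1}^{X}G_i$, where $(G_i)_{i\ge1}$ is i.i.d., $\mathbb{Z}_+$-valued, independent of $X$, with pgf $$\Psi_G(s)=1-\alpha\frac{1-s}{1+r^{-1}(1-\alpha)\mu(1-s)}.$$ The INAR(1) process is the $\mathbb{Z}_+$-valued process satisfying $X_{t+1}=(\alpha,\mu,r)\star X_t+\varepsilon_{t+1}$, $t\ge0$, where the innovations $(\varepsilon_t)$ are i.i.d. and independent of the counting variables $G_i$ (a Galton–Watson branching process with immigration: fresh copies of the $G_i$ are used at each time, and these and $\varepsilon_{t+1}$ are independent of $X_0,\dots,X_t$). Here $\varepsilon_t\sim NB(r,(1-\alpha)\mu)$, and stationarity is achieved by $X_0\sim NB(r,\mu)$. For an integer $n\ge1$, $0\le i\le n$ and $0<y<1$, $A_i^{(n)}(y)=\binom{n}{i}y^i(1-y)^{n-i}$; for real $n\ge l>0$ and $0<y<1$, $B_l^{(n)}(y)=\frac{\Gamma(n)}{\Gamma(l)\Gamma(n-l+1)}y^l(1-y)^{n-l}$. Empty sums are $0$. *)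

(* Defs.v *)
From HB Require Import structures.
From mathcomp Require Export all_boot all_order all_algebra.
From mathcomp Require Export all_classical all_reals all_analysis.

Set Implicit Arguments.
Unset Strict Implicit.
Unset Printing Implicit Defensive.

Import Order.TTheory GRing.Theory Num.Theory.
Import numFieldNormedType.Exports.

Local Open Scope classical_set_scope.
Local Open Scope ring_scope.

Section Probability.
Context {d : measure_display} {T : measurableType d} {R : realType}
  (P : probability T R).
Implicit Types (F : set_system T) (Y Z V : T -> R).

Definition sigma_rv (X : T -> nat) : set_system T :=
  preimage_set_system setT X measurable.

Definition sigma_family {I : Type} (D : set I) (X : I -> T -> nat) :
  set_system T := <<s \bigcup_(i in D) sigma_rv (X i) >>.

Definition independent_sigma (F F' : set_system T) : Prop :=
  forall A B, F A -> F' B -> P (A `&` B) = (P A * P B)%E.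

Definition mutually_independent {I : eqType} (X : I -> T -> nat) : Prop :=
  forall (J : seq I) (B : I -> set nat), uniq J ->
    P (\bigcap_(i in [set` J]) X i @^-1` B i) =
    (\prod_(i <- J) P (X i @^-1` B i))%E.

Definition stationary (X : nat -> T -> nat) : Prop :=
  forall (n k : nat) (B : nat -> set nat),
    P (\bigcap_(i in `I_n) X (i + k)%N @^-1` B i) =
    P (\bigcap_(i in `I_n) X i @^-1` B i).

(* Probability generating functions are considered on the real interval
   [-1, 1], where the expectation always exists. *)
Definition has_pgf (X : T -> nat) (psi : R -> R) : Prop :=
  forall s : R, `|s| <= 1 -> 'E_P[fun w => (s ^+ X w)%R]%E = (psi s)%:E.

Definition NB_pgf (r m s : R) : R := (1 + m / r * (1 - s)) `^ (- r).

Definition NB_distributed (X : T -> nat) (r m : R) : Prop :=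
  has_pgf X (NB_pgf r m).

(* Z is a version of E(Y | F); it is unique up to P-null sets. *)
Definition is_cond_expectation F Y Z : Prop :=
  [/\ P.-integrable setT (EFin \o Y),
      P.-integrable setT (EFin \o Z),
      forall B : set R, measurable B -> F (Z @^-1` B) &
      forall A, F A ->
        (\int[P]_(w in A) (Z w)%:E = \int[P]_(w in A) (Y w)%:E)%E].

Definition is_cond_variance F Y V : Prop :=
  exists2 M : T -> R, is_cond_expectation F Y M &
    is_cond_expectation F (fun w => (Y w - M w) ^+ 2) V.

Definition is_cond_pgf F (X : T -> nat) (psi : R -> T -> R) : Prop :=
  forall s : R, `|s| <= 1 -> is_cond_expectation F (fun w => s ^+ X w) (psi s).

Definition cond_prob (A B : set T) : R := fine (P (A `&` B)) / fine (P B).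

Definition thinning_pgf (alpha mu r s : R) : R :=
  1 - alpha * ((1 - s) / (1 + r^-1 * (1 - alpha) * mu * (1 - s))).

Definition thinning (G : nat -> T -> nat) (X : T -> nat) (w : T) : nat :=
  (\sum_(i < X w) G i w)%N.

(* All sources of randomness after time 0: the index (t, Some i) is the i-th
   counting variable used in the step from t to t + 1, and (t, None) is the
   innovation of that step. *)
Definition noise (G : nat -> nat -> T -> nat) (eps : nat -> T -> nat)
    (k : nat * option nat) : T -> nat :=
  if k.2 is Some i then G k.1 i else eps k.1.+1.

(* eps 0 plays no role: the innovations are eps 1, eps 2, ... *)
Record INAR1 (alpha mu r : R) (X : nat -> {RV P >-> nat})
    (G : nat -> nat -> {RV P >-> nat}) (eps : nat -> {RV P >-> nat}) : Prop := {
  INAR1_counting : forall t i, has_pgf (G t i) (thinning_pgf alpha mu r);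
  INAR1_innovation : forall t (B : set nat),
    P (eps t.+1 @^-1` B) = P (eps 1%N @^-1` B);
  INAR1_noise : mutually_independent (noise G eps);
  INAR1_past : forall t,
    independent_sigma (sigma_family [set s | (s <= t)%N] X)
      (sigma_family [set k | k.1 = t] (noise G eps));
  INAR1_rec : forall t w, X t.+1 w = (thinning (G t) (X t) w + eps t.+1 w)%N
}.

End Probability.

Section Coefficients.
Context {R : realType}.

Definition Gamma (x : R) : R :=
  Rintegral lebesgue_measure `]0, +oo[ (fun t => t `^ (x - 1) * expR (- t)).

(* A_i^{(n)}(y) *)
Definition binomial_weight (n i : nat) (y : R) : R :=
  'C(n, i)%:R * y ^+ i * (1 - y) ^+ (n - i).

(* B_l^{(n)}(y), with real parameters n >= l > 0 *)
Definition negbinomial_weight (n l y : R) : R :=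
  Gamma n / (Gamma l * Gamma (n - l + 1)) * y `^ l * (1 - y) `^ (n - l).

End Coefficients.

(* Main.v *)
(* The h-step transition is obtained by iterating the one-step identity
   E(s^X_{t+1}; A) = kappa(s) E(psi(s)^X_t; A), A in the past of t, where psi
   is the thinning pgf and kappa the innovation pgf; both families are closed
   under the iteration because the maps u |-> a u / (1 + (1 - a) c u),
   c = mu / r, form a semigroup in a.  As everything is discrete, conditioning
   on X_t amounts to working on the atoms {X_t = i}.  Moments and transition
   probabilities are then read off from finite polynomial expansions of
   the conditional pgf with a O(s^n) remainder, at s = 1 and at s = 0
   respectively; their coefficients are unique, so no power series are
   needed. *)
Require Import Defs.
From mathcomp Require Import all_boot all_order all_algebra.
From mathcomp Require Import all_classical all_reals all_analysis.
From mathcomp Require Import measurable_realfun ring lra zify.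

Set Implicit Arguments.
Unset Strict Implicit.
Unset Printing Implicit Defensive.

Import Order.TTheory GRing.Theory Num.Theory.
Import numFieldNormedType.Exports.
Local Open Scope classical_set_scope.
Local Open Scope ring_scope.

(** Three obstacles shape the proof. The moments of X_{t+h} are not known to exist beforehand, so
    the pgf is not differentiated at 1 under the integral: (1 - s^n)/(1 - s) and the next divided
    difference, polynomials in s with nonnegative coefficients and values n and C(n,2) at s = 1, are
    integrated at s < 1, and monotone convergence yields existence and value at once. The identities
    on the atoms {X_t = i} do not by themselves give integrability over the whole space, so the same
    expansion at 1 is also made for the NB marginal. Finally, Gamma is an integral with a real
    argument, and the weights B become coefficients of a binomial series only through Gamma(x + 1) =
    x Gamma(x), obtained by integration by parts on compact intervals. *)

(** * Polynomial expansions at 0 and the binomial series *)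

Section Expansions.
Context {R : realType}.
Implicit Types (f g : R -> R) (p q : {poly R}).

(* f = p + O(s^n) as s -> 0+; the range (0, 1/2] keeps the pgfs below away from
   their poles. *)
Definition expansion (n : nat) f p :=
  exists C : R, forall s : R, 0 < s <= 2^-1 -> `|f s - p.[s]| <= C * s ^+ n.

Lemma horner_bounded p :
  exists M : R, forall s : R, 0 < s <= 2^-1 -> `|p.[s]| <= M.
Proof.
elim/poly_ind: p => [|p c [M HM]]; first by exists 0 => s _; rewrite horner0 normr0.
exists (M + `|c|) => s hs; rewrite hornerMXaddC.
apply: le_trans (ler_normD _ _) _; rewrite lerD2r normrM.
apply: le_trans (HM s hs); rewrite ler_piMr//.
by case/andP: hs => s0 s1; rewrite ger0_norm; lra.
Qed.

(** Letting s tend to 0 kills the constant coefficient; dividing the bound by s then lowers both the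
    degree and [n], whence the induction. *)
Lemma coef_eq0_bigO n p C :
  (forall s : R, 0 < s <= 2^-1 -> `|p.[s]| <= C * s ^+ n) ->
  forall k, (k < n)%N -> p`_k = 0.
Proof.
elim: n p C => [//|n IH]; elim/poly_ind => [|p c _] C hp; first by move=> k _; rewrite coef0.
have C0 : 0 <= C.
  have := hp 2^-1 ltac:(lra).
  by move=> /(le_trans (normr_ge0 _)); rewrite pmulr_lge0// exprn_gt0// invr_gt0.
have [M HM] := horner_bounded p.
have c0 : c = 0.
  apply/eqP; apply: contraT => cn0.
  have cp : 0 < `|c| by rewrite normr_gt0.
  have M0 : 0 <= M.
    by apply: le_trans (HM 2^-1 ltac:(lra)).
  (* Small enough for a contradiction: (C + M) s < |c|, whereas |c| <= |p(s) s + c| + |p(s) s| <= (C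
     + M) s. The 1 in the denominator keeps it positive. *)
  pose s := Num.min (2^-1) (`|c| / (2 * (C + M + 1))).
  have D0 : 0 < 2 * (C + M + 1) by lra.
  have hs : 0 < s <= 2^-1.
    by rewrite /s lt_min ge_min lexx /= andbT invr_gt0 ltr0n /= divr_gt0.
  have sc : s * (2 * (C + M + 1)) <= `|c|.
    by rewrite -ler_pdivlMr// /s ge_min lexx orbT.
  have := hp _ hs; rewrite hornerMXaddC exprSr mulrA => h1.
  have h2 := HM _ hs; case/andP: (hs) => s0 s1.
  have s2 : s ^+ n <= 1 by apply: exprn_ile1; lra.
  have h3 : C * s ^+ n * s <= C * s.
    by apply: ler_wpM2r; [exact: ltW | exact: ler_piMr].
  have h4 : `|p.[s] * s| <= M * s.
    by rewrite normrM (ger0_norm (ltW s0)); apply: ler_wpM2r; first exact: ltW.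
  have h5 : `|c| <= `|p.[s] * s + c| + `|p.[s] * s|.
    by rewrite -{1}(addKr (p.[s] * s) c) addrC (le_trans (ler_normB _ _))// addrC.
  nra.
subst c; move=> [|k] kn; rewrite addr0 coefMX//=.
apply: (IH p C) => // s hs; have := hp s hs.
rewrite hornerMXaddC addr0 normrM exprSr mulrA; case/andP: hs => s0 _.
by rewrite (ger0_norm (ltW s0)) ler_pM2r.
Qed.

Lemma expansion_coef_unique n f p q : expansion n f p -> expansion n f q ->
  forall k, (k < n)%N -> p`_k = q`_k.
Proof.
move=> [C hp] [D hq] k kn; apply/eqP; rewrite -subr_eq0 -coefB; apply/eqP.
apply: (@coef_eq0_bigO n _ (C + D)) kn => s hs.
rewrite hornerD hornerN mulrDl.
apply: le_trans (lerD (hp s hs) (hq s hs)).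
rewrite (distrC (f s) p.[s]).
by apply: le_trans (ler_normD _ _); rewrite addrA subrK.
Qed.

Lemma expansion_ext n f g p : (forall s, 0 < s <= 2^-1 -> f s = g s) ->
  expansion n f p -> expansion n g p.
Proof. by move=> fg [C hC]; exists C => s hs; rewrite -fg// hC. Qed.

Lemma expansion_horner n p : expansion n (horner p) p.
Proof. by exists 0 => s _; rewrite subrr normr0 mul0r. Qed.

Lemma expansionD n f g p q : expansion n f p -> expansion n g q ->
  expansion n (fun s => f s + g s) (p + q).
Proof.
move=> [C hC] [D hD]; exists (C + D) => s hs; rewrite hornerD mulrDl.
apply: le_trans (lerD (hC s hs) (hD s hs)).
by apply: le_trans (ler_normD _ _); rewrite opprD addrACA.
Qed.

Lemma expansionM n f g p q : expansion n f p -> expansion n g q ->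
  expansion n (fun s => f s * g s) (p * q).
Proof.
move=> [C hC] [D hD].
have [M hM] := horner_bounded p; have [N hN] := horner_bounded q.
exists (C * (N + `|D|) + M * D) => s hs; rewrite hornerM.
have -> : f s * g s - p.[s] * q.[s]
    = (f s - p.[s]) * g s + p.[s] * (g s - q.[s]) by ring.
apply: le_trans (ler_normD _ _) _; rewrite !normrM mulrDl.
case/andP: (hs) => s0 s1.
have sn : 0 < s ^+ n by apply: exprn_gt0.
apply: lerD.
  rewrite mulrAC; apply: ler_pM => //; first exact: hC.
  rewrite -(subrK q.[s] (g s)); apply: le_trans (ler_normD _ _) _.
  rewrite addrC lerD// ?hN//; apply: le_trans (hD s hs) _.
  apply: le_trans (ler_norm _) _; rewrite normrM (ger0_norm (ltW sn)).
  by rewrite ler_piMr//; apply: exprn_ile1; lra.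
by rewrite -mulrA; apply: ler_pM => //; [exact: hM | exact: hD].
Qed.

Lemma expansionZ n (c : R) f p : expansion n f p ->
  expansion n (fun s => c * f s) (c *: p).
Proof.
move=> hf; rewrite -mul_polyC; apply: expansionM hf.
by apply: expansion_ext (expansion_horner _ _) => s _; rewrite hornerC.
Qed.

Lemma expansionX n f p k : expansion n f p ->
  expansion n (fun s => f s ^+ k) (p ^+ k).
Proof.
move=> hf; elim: k => [|k IH].
  apply: (@expansion_ext _ (horner 1)) => [s _|]; last exact: expansion_horner.
  by rewrite hornerE.
rewrite exprS; apply: (@expansion_ext _ (fun s => f s * f s ^+ k)).
  by move=> s _; rewrite exprS.
exact: expansionM.
Qed.

Lemma expansion_sum n (I : Type) (l : seq I) (F : I -> R -> R) (p : I -> {poly R}) :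
  (forall i, expansion n (F i) (p i)) ->
  expansion n (fun s => \sum_(i <- l) F i s) (\sum_(i <- l) p i).
Proof.
move=> h; elim: l => [|i l IH].
  rewrite big_nil; apply: (@expansion_ext _ (horner 0)) => [s _|].
    by rewrite horner0 big_nil.
  exact: expansion_horner.
rewrite big_cons.
apply: (@expansion_ext _ (fun s => F i s + \sum_(i <- l) F i s)) => [s _|].
  by rewrite big_cons.
exact: expansionD.
Qed.

(** Pochhammer symbol: [rising r j] divided by j! is the generalized binomial coefficient C(r + j -
    1, j). *)
Definition rising (x : R) (j : nat) := \prod_(i < j) (x + i%:R).

Lemma risingS x j : rising x j.+1 = x * rising (x + 1) j.
Proof.
rewrite /rising big_ord_recl addr0; congr (_ * _); apply: eq_bigr => i _.
by rewrite /= -addrA nat1r.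
Qed.

Lemma rising_gt0 x j : 0 < x -> 0 < rising x j.
Proof. by move=> x0; apply: prodr_gt0 => i _; rewrite ltr_pwDl. Qed.

(** Taylor polynomial at 0 of (1 - x s)^(-r). *)
Definition negbin_poly (n : nat) (r x : R) : {poly R} :=
  \poly_(j < n) (rising r j / j`!%:R * x ^+ j).

Lemma deriv_negbin_poly n r x :
  (negbin_poly n.+1 r x)^`() = (r * x) *: negbin_poly n (r + 1) x.
Proof.
apply/polyP => j; rewrite coef_deriv coefZ !coef_poly ltnS.
case: ifP => _; last by rewrite mulr0 mul0rn.
rewrite risingS factS natrM exprS -mulr_natr.
have j0 : (j`!%:R : R) != 0 by rewrite pnatr_eq0 -lt0n fact_gt0.
by field; rewrite j0 nat1r pnatr_eq0.
Qed.

(** Keeps (1 - x s)^(-r) bounded on the range of [expansion]. Here [x] may be very negative: the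
    expansions made for the moments use x = -b. *)
Lemma half_le_affine (x s : R) : x < 1 -> 0 <= s <= 2^-1 -> 2^-1 <= 1 - x * s.
Proof. by move=> x1 /andP[s0 s1]; nra. Qed.

(* The derivative of the n-th remainder for r is r x times the (n-1)-th
   remainder for r + 1. *)
Lemma expansion_negbin n (r x : R) : 0 < r -> x < 1 ->
  expansion n (fun s => (1 - x * s) `^ (- r)) (negbin_poly n r x).
Proof.
move=> + x1; elim: n r => [|n IH] r r0.
  exists (2^-1 `^ (- r)) => s /andP[s0 s1].
  rewrite expr0 mulr1 /negbin_poly poly_def big_ord0 horner0 subr0.
  have h : 2^-1 <= 1 - x * s by apply: half_le_affine; rewrite // (ltW s0).
  have h0 : 0 < 1 - x * s by lra.
  rewrite ger0_norm ?powR_ge0// !powRN lef_pV2 ?posrE ?powR_gt0//.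
  by apply: ge0_ler_powR => //; rewrite ?nnegrE; lra.
have [C hC] := IH (r + 1) ltac:(lra).
exists (`|r * x| * C) => s /andP[s0 s1].
pose F (t : R) := (1 - x * t) `^ (- r) - (negbin_poly n.+1 r x).[t].
pose dF (t : R) := r * x * ((1 - x * t) `^ (- (r + 1)) - (negbin_poly n (r + 1) x).[t]).
have F' (t : R) : 0 <= t <= 2^-1 -> is_derive t 1 F (dF t).
  move=> ht; have h := half_le_affine x1 ht.
  have h0 : 0 < 1 - x * t by apply: lt_le_trans h; rewrite invr_gt0.
  pose g (t : R) := 1 - x * t.
  have h1 : is_derive t 1 g (- x).
    by apply: is_derive_eq; rewrite /GRing.scale /=; ring.
  have h2 := @is_derive1_comp _ _ g _ _ _ (is_derive1_powR (- r) h0) h1.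
  have h3 := is_deriveB h2 (is_derive_poly (negbin_poly n.+1 r x) t).
  apply: (is_derive_eq h3).
  rewrite deriv_negbin_poly hornerZ /dF opprD /=.
  by rewrite /GRing.scale /=; ring.
have F0 : F 0 = 0.
  rewrite /F mulr0 subr0 powR1 horner_coef0 coef_poly /= /rising big_ord0.
  by rewrite fact0 expr0 divr1 mulr1 subrr.
have := @MVT R F dF 0 s s0.
case.
- by move=> t; rewrite in_itv/= => /andP[t0 ts]; apply: F'; lra.
- apply: derivable_within_continuous => t; rewrite in_itv/= => /andP[t0 ts].
  by have [] : is_derive t 1 F (dF t) by apply: F'; lra.
move=> c; rewrite in_itv/= => /andP[c0 cs].
rewrite F0 !subr0 -/(F s) => ->.
rewrite normrM (ger0_norm (ltW s0)) exprSr mulrA ler_wpM2r ?(ltW s0)//.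
rewrite /dF normrM -mulrA ler_wpM2l//.
have hc : 0 < c <= 2^-1 by lra.
apply: le_trans (hC c hc) _.
have C0 : 0 <= C.
  have := le_trans (normr_ge0 _) (hC c hc).
  by rewrite pmulr_lge0// exprn_gt0.
by rewrite ler_wpM2l// lerXn2r// ?nnegrE; lra.
Qed.

End Expansions.

(** * The Gamma function: recurrence, finiteness, positivity *)

Section GammaFunction.
Context {R : realType}.
Local Notation mu := (@lebesgue_measure R).
Implicit Types x y t : R.

(** The exponent is unshifted, so that the derivative is x times the integrand of Gamma(x) minus the
    integrand of Gamma(x + 1). *)
Definition gamma_integrand x t := t `^ x * expR (- t).

(** Compact exhaustion of the open half-line, where the fundamental theorem of calculus applies; the
    offset 2 makes even the first interval nondegenerate. *)
Definition gamma_window (n : nat) : set R := `[n.+2%:R^-1, n.+2%:R].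

(** Kept in the extended reals so that the recurrence can be proved before finiteness and then serve
    to prove it. *)
Definition gamma_integral x : \bar R :=
  integral mu `]0, +oo[ (fun t : R => (gamma_integrand (x - 1) t)%:E).

Lemma GammaE x : Gamma x = fine (gamma_integral x).
Proof. by []. Qed.

Lemma gamma_integrand_ge0 x t : 0 <= gamma_integrand x t.
Proof. by rewrite mulr_ge0 ?powR_ge0 ?expR_ge0. Qed.

Lemma is_derive_gamma_integrand x t : 0 < t ->
  is_derive t 1 (gamma_integrand x)
    (x * gamma_integrand (x - 1) t - gamma_integrand x t).
Proof.
move=> t0.
have h1 : is_derive t 1 (fun t : R => - t) (-1) by apply: is_derive_eq.
have h2 := is_derive1_comp (is_derive_expR (- t)) h1.
have h3 := is_deriveM (is_derive1_powR x t0) h2.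
apply: (is_derive_eq h3).
by rewrite /gamma_integrand /GRing.scale /=; ring.
Qed.

Lemma gamma_window_lt n : (n.+2%:R^-1 : R) < n.+2%:R.
Proof.
apply: (@lt_trans _ _ 1); last by rewrite ltr1n.
by rewrite invf_lt1// ltr1n.
Qed.

Lemma gamma_window_gt0 n t : gamma_window n t -> 0 < t.
Proof.
rewrite /gamma_window /= in_itv /= => /andP[+ _].
by apply: lt_le_trans; rewrite invr_gt0.
Qed.

Lemma bigcup_gamma_window : \bigcup_n gamma_window n = `]0, +oo[%classic :> set R.
Proof.
apply/seteqP; split => t.
  by case=> n _ /gamma_window_gt0 t0; rewrite /= in_itv /= t0.
rewrite /= in_itv /= andbT => t0.
have [N hN] : exists N : nat, t + t^-1 <= N%:R.
  by exists (Num.truncn (t + t^-1)).+1; rewrite ltW// truncnS_gt.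
have ti0 : 0 < t^-1 by rewrite invr_gt0.
have NN : (N%:R : R) <= N.+2%:R by rewrite ler_nat; lia.
exists N => //; rewrite /gamma_window /= in_itv /=; apply/andP; split.
  by rewrite -(invrK t) lef_pV2 ?posrE//; lra.
by lra.
Qed.

Lemma nondecreasing_gamma_window : nondecreasing_seq gamma_window.
Proof.
move=> m n mn; apply/subsetPset => t.
rewrite /gamma_window /= !in_itv /= => /andP[h1 h2]; apply/andP; split.
  by apply: le_trans h1; rewrite lef_pV2 ?posrE// ler_nat ltnS ltnS.
by apply: le_trans h2 _; rewrite ler_nat ltnS ltnS.
Qed.

Lemma continuous_gamma_integrand x n :
  {within gamma_window n, continuous (gamma_integrand x)}.
Proof.
apply: derivable_within_continuous => t /= ht.
have t0 : 0 < t by apply: (@gamma_window_gt0 n).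
by have [] := is_derive_gamma_integrand x t0.
Qed.

Lemma integrable_gamma_window x n :
  mu.-integrable (gamma_window n) (EFin \o gamma_integrand x).
Proof.
apply: continuous_compact_integrable; first exact: segment_compact.
exact: continuous_gamma_integrand.
Qed.

Lemma measurable_gamma_integrand x (D : set R) : measurable D ->
  measurable_fun D (gamma_integrand x).
Proof.
move=> mD; apply: measurable_funM.
  by apply: measurable_funTS; exact: measurable_powR.
apply: measurable_funTS; apply: measurableT_comp => //.
Qed.

Lemma cvg_gamma_window x :
  (\int[mu]_(t in gamma_window n) (gamma_integrand (x - 1) t)%:E)%E @[n --> \oo]
    --> gamma_integral x.
Proof.
rewrite /gamma_integral -bigcup_gamma_window.
have mW n : measurable (gamma_window n) by exact: measurable_itv.
have mf n : measurable_fun (gamma_window n)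
    (fun t => (gamma_integrand (x - 1) t)%:E).
  by apply/measurable_EFinP; apply: measurable_gamma_integrand; exact: mW.
have f0 n t : gamma_window n t -> (0 <= (gamma_integrand (x - 1) t)%:E)%E.
  by rewrite lee_fin gamma_integrand_ge0.
have H := @ge0_nondecreasing_set_cvg_integral _ _ R _ _ mu nondecreasing_gamma_window mW mf f0.
exact: H.
Qed.

Lemma gamma_window_rec x n :
  ((x%:E * \int[mu]_(t in gamma_window n) (gamma_integrand (x - 1) t)%:E)
  = \int[mu]_(t in gamma_window n) (gamma_integrand x t)%:E
    + (gamma_integrand x n.+2%:R - gamma_integrand x (n.+2%:R^-1))%:E)%E.
Proof.
have mW : measurable (gamma_window n) by exact: measurable_itv.
have i1 := integrable_gamma_window (x - 1) n.
have i2 := integrable_gamma_window x n.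
rewrite EFinB -(@continuous_FTC2 _
  (fun t => x * gamma_integrand (x - 1) t - gamma_integrand x t)
  (gamma_integrand x)).
- rewrite -integralZl// -[LHS]addr0.
  under [X in (_ + X)%E]eq_integral do rewrite EFinB EFinM.
  rewrite integralB//; last by apply: integrableZl.
  by rewrite addr0 addeC subeK// integrable_fin_num.
- exact: gamma_window_lt.
- apply: derivable_within_continuous => t ht.
  have t0 : 0 < t by apply: (@gamma_window_gt0 n).
  have [d1 _] := is_derive_gamma_integrand (x - 1) t0.
  have [d2 _] := is_derive_gamma_integrand x t0.
  apply: derivableB; last exact: d2.
  by apply: derivableM; [exact: derivable_cst | exact: d1].
- have c t : 0 < t -> {for t, continuous (gamma_integrand x)}.
    move=> t0; apply: differentiable_continuous; apply/derivable1_diffP.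
    by have [] := is_derive_gamma_integrand x t0.
  split.
  + move=> t; rewrite in_itv/= => /andP[t0 _].
    have t1 : 0 < t by apply: lt_trans t0; rewrite invr_gt0.
    by have [] := is_derive_gamma_integrand x t1.
  + by apply: cvg_at_right_filter; apply: c; rewrite invr_gt0.
  + by apply: cvg_at_left_filter; apply: c.
- move=> t; rewrite in_itv/= => /andP[t0 _].
  have t1 : 0 < t by apply: lt_trans t0; rewrite invr_gt0.
  by rewrite derive1E; have [_ ->] := is_derive_gamma_integrand x t1.
Qed.

(** A single term of the exponential series suffices: t^x t <= t^(m+1) <= (m+1)! e^t. *)
Lemma gamma_integrand_le x m t : 1 <= t -> x <= m%:R ->
  gamma_integrand x t <= m.+1`!%:R / t.
Proof.
move=> t1 xm; have t0 : 0 < t by lra.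
rewrite /gamma_integrand expRN ler_pdivlMr// mulrAC ler_pdivrMr ?expR_gt0//.
have h1 : t `^ x * t <= t ^+ m.+1.
  rewrite exprSr; apply: ler_wpM2r; first exact: ltW.
  by rewrite -(powR_mulrn m (ltW t0)); exact: ler_powR.
apply: le_trans h1 _.
have := expR_ge1Dxn m (ltW t0).
have f0 : 0 < (m.+1`!%:R : R) by rewrite ltr0n fact_gt0.
have : t ^+ m.+1 / m.+1`!%:R * m.+1`!%:R = t ^+ m.+1.
  by rewrite divfK// gt_eqF.
set z := t ^+ m.+1 / _ => <- ez.
by rewrite mulrC; apply: ler_wpM2l; [exact: ltW | lra].
Qed.

Lemma cvg_gamma_boundary x : 0 < x ->
  gamma_integrand x n.+2%:R - gamma_integrand x (n.+2%:R^-1) @[n --> \oo] --> 0.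
Proof.
move=> x0; rewrite -(subr0 0); apply: cvgB.
  pose m := (Num.truncn x).+1.
  have xm : x <= m%:R by rewrite ltW// truncnS_gt.
  apply: (@squeeze_cvgr _ _ _ _ (fun=> 0) (fun n : nat => m.+1`!%:R * n.+2%:R^-1)).
  - apply: nearW => n; rewrite gamma_integrand_ge0 /=.
    by apply: gamma_integrand_le => //; rewrite ler1n.
  - exact: cvg_cst.
  - rewrite -(mulr0 m.+1`!%:R); apply: cvgMr.
    by have := @cvg_harmonic R; rewrite -(cvg_shiftS (@harmonic R)).
apply: (@squeeze_cvgr _ _ _ _ (fun=> 0) (fun n : nat => n.+2%:R^-1 `^ x)).
- apply: nearW => n; rewrite gamma_integrand_ge0 /= /gamma_integrand.
  by rewrite ler_piMr ?powR_ge0// expR_le1 oppr_le0 invr_ge0.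
- exact: cvg_cst.
- apply: ((cvg_at_rightP _ _ _).1 (powR_cvg0 x0) (fun n : nat => n.+2%:R^-1)).
  split; first by move=> n; rewrite invr_gt0.
  by have := @cvg_harmonic R; rewrite -(cvg_shiftS (@harmonic R)).
Qed.

Lemma gamma_integral_rec x : 0 < x ->
  gamma_integral (x + 1) = (x%:E * gamma_integral x)%E.
Proof.
move=> x0; have h1 := @cvg_gamma_window (x + 1).
have h2 : (x%:E * \int[mu]_(t in gamma_window n)
    (gamma_integrand (x - 1) t)%:E)%E @[n --> \oo] --> (x%:E * gamma_integral x)%E.
  by apply: cvgeZl => //; exact: cvg_gamma_window.
have h3 : (gamma_integrand x n.+2%:R - gamma_integrand x (n.+2%:R^-1))%:E
    @[n --> \oo] --> 0%:E.
  by apply: cvg_EFin; [exact: nearW | exact: cvg_gamma_boundary].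
have h4 : (x%:E * \int[mu]_(t in gamma_window n)
    (gamma_integrand (x - 1) t)%:E)%E @[n --> \oo] --> gamma_integral (x + 1).
  under eq_fun do rewrite gamma_window_rec.
  rewrite -(adde0 (gamma_integral _)); apply: cvgeD h3; first exact: fin_num_adde_defl.
  by rewrite addrK in h1.
exact: (cvg_unique _ h4 h2).
Qed.

Lemma gamma_integral1 : gamma_integral 1 = 1%E.
Proof.
have e n : (\int[mu]_(t in gamma_window n) (gamma_integrand (1 - 1) t)%:E =
    (gamma_integrand 0 (n.+2%:R^-1) - gamma_integrand 0 n.+2%:R)%:E)%E.
  (* At x = 0 the left side vanishes and the integral of e^(-t) is left as a boundary difference. *)
  have := gamma_window_rec 0 n; rewrite mul0e subrr.
  have : (\int[mu]_(t in gamma_window n) (gamma_integrand 0 t)%:E)%E \is a fin_num.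
    apply: integrable_fin_num; first exact: measurable_itv.
    exact: integrable_gamma_window.
  move=> /fineK <-; rewrite -EFinD => -[h]; congr EFin; lra.
suff h1 : (\int[mu]_(t in gamma_window n) (gamma_integrand (1 - 1) t)%:E)%E
    @[n --> \oo] --> (1 - 0 : R)%:E.
  by rewrite subr0 in h1; exact: (cvg_unique _ (@cvg_gamma_window 1) h1).
under eq_fun do rewrite e.
apply: cvg_EFin; first exact: nearW.
have h : (n.+2%:R^-1 : R) @[n --> \oo] --> 0.
  by have := @cvg_harmonic R; rewrite -(cvg_shiftS (@harmonic R)).
apply: cvgB.
  rewrite /gamma_integrand; under eq_fun do rewrite powRr0 mul1r.
  have he : expR (- (n.+2%:R^-1 : R)) @[n --> \oo] --> expR (- 0 : R).
    by apply: continuous_cvg; [exact: continuous_expR | exact: cvgN].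
  by rewrite oppr0 expR0 in he.
apply: (@squeeze_cvgr _ _ _ _ (fun=> 0) (fun n : nat => 1`!%:R * n.+2%:R^-1)).
- apply: nearW => n; rewrite gamma_integrand_ge0 /=.
  by apply: gamma_integrand_le => //; rewrite ler1n.
- exact: cvg_cst.
- by rewrite -(mulr0 1`!%:R); apply: cvgMr.
Qed.

Lemma gamma_integral_ge0 x : (0 <= gamma_integral x)%E.
Proof. by apply: integral_ge0 => t _; rewrite lee_fin gamma_integrand_ge0. Qed.

Lemma gamma_integral_nat_fin n : gamma_integral n.+1%:R \is a fin_num.
Proof.
elim: n => [|n IH]; first by rewrite gamma_integral1.
by rewrite -natr1 gamma_integral_rec// fin_numM.
Qed.

(** At natural arguments the recurrence gives finiteness. At x + 1 the bound t^x <= 1 + t^m with m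
    >= x dominates by Gamma(1) + Gamma(m + 1). The recurrence read backwards then descends to x,
    where the integrand may be unbounded near 0. *)
Lemma gamma_integral_fin x : 0 < x -> gamma_integral x \is a fin_num.
Proof.
move=> x0; suff : gamma_integral (x + 1) \is a fin_num.
  rewrite gamma_integral_rec// => h.
  have := gamma_integral_ge0 x; move: h; case: (gamma_integral x) => //.
  by rewrite gt0_muley// lte_fin.
pose m := (Num.truncn x).+1.
have xm : x <= m%:R by rewrite ltW// truncnS_gt.
rewrite ge0_fin_numE ?gamma_integral_ge0//.
apply: (@le_lt_trans _ _ (gamma_integral 1 + gamma_integral m.+1%:R)%E); last first.
  rewrite lte_add_pinfty//; last by rewrite ltey_eq gamma_integral_nat_fin.
  by rewrite gamma_integral1 ltey.
have mD : measurable (`]0, +oo[ : set R) by exact: measurable_itv.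
have mg y : measurable_fun (`]0, +oo[ : set R) (fun t => (gamma_integrand y t)%:E).
  by apply/measurable_EFinP; apply: measurable_gamma_integrand.
have g0 y t : (0 <= (gamma_integrand y t)%:E)%E.
  by rewrite lee_fin gamma_integrand_ge0.
rewrite /gamma_integral -ge0_integralD//; [|exact: mg|exact: mg].
apply: ge0_le_integral => //; [exact: mg|by apply: emeasurable_funD; exact: mg|].
move=> t /=; rewrite in_itv/= andbT => t0.
rewrite -EFinD lee_fin /gamma_integrand -mulrDl.
apply: ler_wpM2r; first exact: expR_ge0.
rewrite subrr powRr0 addrK -natr1 addrK.
have [t1|t1] := leP t 1.
  apply: (@le_trans _ _ 1); last by rewrite lerDl powR_ge0.
  rewrite -[leRHS](powRr0 t); apply: ger_powR; last exact: ltW.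
  by rewrite t0.
apply: (@le_trans _ _ (t `^ m%:R)); last by rewrite lerDr.
by apply: ler_powR => //; exact: ltW.
Qed.

Lemma Gamma_rec x : 0 < x -> Gamma (x + 1) = x * Gamma x.
Proof.
move=> x0; rewrite !GammaE gamma_integral_rec// fineM//.
exact: gamma_integral_fin.
Qed.

Lemma Gamma1 : Gamma (1 : R) = 1.
Proof. by rewrite GammaE gamma_integral1. Qed.

Lemma Gamma_gt0 x : 0 < x -> 0 < Gamma x.
Proof.
move=> x0; rewrite GammaE fine_gt0// -ge0_fin_numE ?gamma_integral_ge0//.
rewrite gamma_integral_fin// andbT.
(* On [1, 2] one has t^(x-1) >= t^(-1) >= 1/2 and e^(-t) >= e^(-2). *)
pose c : R := 2^-1 * expR (- 2).
have c0 : 0 < c by rewrite mulr_gt0 ?invr_gt0 ?expR_gt0.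
apply: (@lt_le_trans _ _ (\int[mu]_(t in `[1%R, 2%R]) (c%:E))%E).
  by rewrite integral_cst//= lebesgue_measure_itv /= lte_fin ltr1n -EFinD
    mule_gt0// lte_fin//; lra.
have m12 : measurable (`[1, 2] : set R) by exact: measurable_itv.
have mg (D : set R) : measurable D ->
    measurable_fun D (fun t => (gamma_integrand (x - 1) t)%:E).
  by move=> mD; apply/measurable_EFinP; apply: measurable_gamma_integrand.
have g0 t : (0 <= (gamma_integrand (x - 1) t)%:E)%E.
  by rewrite lee_fin gamma_integrand_ge0.
apply: (@le_trans _ _
    (\int[mu]_(t in `[1%R, 2%R]) (gamma_integrand (x - 1) t)%:E)%E).
  apply: ge0_le_integral => //.
  - by move=> t _; rewrite lee_fin ltW.
  - exact: mg.
  move=> t /=; rewrite in_itv/= => /andP[t1 t2]; rewrite lee_fin.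
  apply: ler_pM; rewrite ?invr_ge0 ?expR_ge0//; last by rewrite ler_expR lerN2.
  apply: (@le_trans _ _ (t `^ (-1))).
    by rewrite powR_inv1 ?lef_pV2 ?posrE//; lra.
  by apply: ler_powR => //; lra.
apply: ge0_subset_integral => //.
  by apply: mg; exact: measurable_itv.
by move=> t /=; rewrite !in_itv/= andbT => /andP[t1 _]; lra.
Qed.

Lemma Gamma_rising x j : 0 < x -> Gamma (x + j%:R) = rising x j * Gamma x.
Proof.
move=> x0; elim: j => [|j IH]; first by rewrite addr0 /rising big_ord0 mul1r.
rewrite -natr1 addrA Gamma_rec; last by rewrite ltr_pwDl.
rewrite IH.
by rewrite /rising big_ord_recr /= mulrA (mulrC (x + j%:R)).
Qed.

Lemma rising1 j : rising (1 : R) j = j`!%:R.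
Proof.
elim: j => [|j IH]; first by rewrite /rising big_ord0 fact0.
rewrite /rising big_ord_recr /= -/(rising 1 j) IH factS natrM mulrC.
by rewrite nat1r.
Qed.

Lemma Gamma_fact n : Gamma (n.+1%:R : R) = n`!%:R.
Proof. by rewrite -nat1r Gamma_rising// rising1 Gamma1 mulr1. Qed.

End GammaFunction.

(** * Measurability of sums of integer-valued variables *)

Section MeasurableNat.
Context {d : measure_display} {T : measurableType d}.

Lemma measurable_nat_add (Y Z : T -> nat) :
  measurable_fun setT Y -> measurable_fun setT Z ->
  measurable_fun setT (fun w => (Y w + Z w)%N).
Proof.
move=> mY mZ _ B _; rewrite setTI.
rewrite (_ : _ @^-1` _ = \bigcup_n (Y @^-1` [set n] `&` Z @^-1` [set m | B (n + m)%N])).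
  apply: bigcup_measurable => n _; apply: measurableI.
    by rewrite -[_ @^-1` _]setTI; exact: mY.
  by rewrite -[_ @^-1` _]setTI; exact: mZ.
apply/seteqP; split => w; first by move=> h; exists (Y w).
by move=> [n _ [/= -> ]].
Qed.

(** Free of any measure, because [past_indep_offspring] applies it to the sigma-algebra generated by
    the noise of one step. *)
Lemma measurable_nat_sum (I : Type) (K : seq I) (Z : I -> T -> nat) :
  (forall i, measurable_fun setT (Z i)) ->
  measurable_fun setT (fun w => (\sum_(k <- K) Z k w)%N).
Proof.
move=> mZ; elim: K => [|k K IH].
  by under eq_fun do rewrite big_nil; exact: measurable_cst.
by under eq_fun do rewrite big_cons; exact: measurable_nat_add.
Qed.

End MeasurableNat.

(** * Integration over the atoms of a discrete variable *)

Section DiscreteExpectation.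
Context {d : measure_display} {T : measurableType d} {R : realType}
  (P : probability T R).
Implicit Types (X Y : T -> nat) (A : set T).

Lemma measurable_preimage_nat Y (B : set nat) :
  measurable_fun setT Y -> measurable (Y @^-1` B).
Proof. by move=> mY; rewrite -[_ @^-1` _]setTI; exact: mY. Qed.

Lemma measurable_comp_nat Y (f : nat -> R) :
  measurable_fun setT Y -> measurable_fun setT (f \o Y).
Proof. by move=> mY; apply: measurableT_comp. Qed.

Lemma bounded_comp_integrable Y (f : nat -> R) (M : R) A :
  measurable_fun setT Y -> measurable A -> (forall n, `|f n| <= M) ->
  P.-integrable A (fun w => (f (Y w))%:E).
Proof.
move=> mY mA fM; apply: (@integrableS _ _ _ P setT) => //.
apply: (@measurable_bounded_integrable _ _ _ P (f \o Y)) => //.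
- by rewrite -ge0_fin_numE//; exact: fin_num_measure.
- exact: measurable_comp_nat.
- exists M; split; first exact: num_real.
  by move=> x Mx w _; apply: le_trans (fM _) (ltW Mx).
Qed.

Lemma fiber_cover Y A : A = \bigcup_n (A `&` Y @^-1` [set n]).
Proof.
apply/seteqP; split => [w Aw|w [n _ []//]].
by exists (Y w).
Qed.

Lemma trivIset_fiber Y A : trivIset setT (fun n => A `&` Y @^-1` [set n]).
Proof.
by apply/trivIsetP => i j _ _ ij; rewrite -subset0 => w [[_ /= Yi] [_ /= Yj]];
  move: ij; rewrite -Yi -Yj eqxx.
Qed.

Lemma measurable_fiber Y A n : measurable_fun setT Y -> measurable A ->
  measurable (A `&` Y @^-1` [set n]).
Proof. by move=> mY mA; apply: measurableI => //; exact: measurable_preimage_nat. Qed.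

Lemma eq_integral_fibers X (f g : T -> \bar R) A :
  measurable_fun setT X -> measurable A ->
  P.-integrable A f -> P.-integrable A g ->
  (forall n, \int[P]_(w in A `&` X @^-1` [set n]) f w =
             \int[P]_(w in A `&` X @^-1` [set n]) g w)%E ->
  (\int[P]_(w in A) f w = \int[P]_(w in A) g w)%E.
Proof.
move=> mX mA fi gi fg; rewrite (fiber_cover X A).
rewrite !integral_bigcup//; try exact: trivIset_fiber;
  try (by move=> k; exact: measurable_fiber); rewrite -?fiber_cover//.
by apply: eq_eseriesr => n _; exact: fg.
Qed.

Lemma integral_fiber_cst (f : T -> \bar R) A (c : R) : measurable A ->
  (forall w, A w -> f w = c%:E) -> (\int[P]_(w in A) f w = c%:E * P A)%E.
Proof.
move=> mA fc; rewrite -integral_cst//; apply: eq_integral => w /set_mem Aw.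
exact: fc.
Qed.

Lemma ge0_integral_indep Y (f : nat -> R) A :
  measurable_fun setT Y -> measurable A -> (forall n, 0 <= f n) ->
  (forall B, P (A `&` Y @^-1` B) = P A * P (Y @^-1` B))%E ->
  (\int[P]_(w in A) (f (Y w))%:E = P A * \int[P]_w (f (Y w))%:E)%E.
Proof.
move=> mY mA f0 ind.
have H D : measurable D -> (\int[P]_(w in D) (f (Y w))%:E =
    \sum_(0 <= n <oo) (f n)%:E * P (D `&` Y @^-1` [set n]))%E.
  move=> mD; rewrite {1}(fiber_cover Y D) ge0_integral_bigcup//=.
  - apply: eq_eseriesr => n _; apply: integral_fiber_cst.
      exact: measurable_fiber.
    by move=> w [_ /= ->].
  - by move=> n; exact: measurable_fiber.
  - rewrite -fiber_cover; apply: measurable_funTS; apply/measurable_EFinP.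
    exact: measurable_comp_nat.
  - by move=> w _; rewrite lee_fin.
  - exact: trivIset_fiber.
rewrite !H// -(fineK (fin_num_measure P _ mA)) -nneseriesZl; last first.
  by move=> n _; rewrite mule_ge0// lee_fin.
apply: eq_eseriesr => n _; rewrite setTI ind fineK ?fin_num_measure//.
by rewrite muleCA.
Qed.

(** Adding the bound [M] reduces to nonnegative f, and the extra finite term M P(A) cancels. Signed
    f occur because s ranges over [-1, 1]. *)
Lemma integral_indep Y (f : nat -> R) (M : R) A :
  measurable_fun setT Y -> measurable A -> (forall n, `|f n| <= M) ->
  (forall B, P (A `&` Y @^-1` B) = P A * P (Y @^-1` B))%E ->
  (\int[P]_(w in A) (f (Y w))%:E = P A * \int[P]_w (f (Y w))%:E)%E.
Proof.
move=> mY mA fM ind.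
have int D : measurable D -> P.-integrable D (fun w => (f (Y w))%:E).
  by move=> mD; exact: bounded_comp_integrable fM.
have intc D : measurable D -> P.-integrable D (fun w => (cst M w)%:E).
  move=> mD; apply: (@bounded_comp_integrable Y (cst M) `|M|) => //.
have H D : measurable D -> (\int[P]_(w in D) (f (Y w) + M)%:E =
    \int[P]_(w in D) (f (Y w))%:E + M%:E * P D)%E.
  move=> mD; under eq_integral do rewrite EFinD.
  by rewrite integralD//; [rewrite integral_cst | exact: int | exact: intc].
have := @ge0_integral_indep Y (fun n => f n + M) A mY mA _ ind.
rewrite !H// => /(_ _) e.
have {}e := e (fun n => ltac:(by have := fM n; rewrite ler_norml => /andP[? _]; lra)).
move: e; rewrite probability_setT mule1 muleDr;
  try exact: (fin_num_measure P _ mA); try exact: fin_num_adde_defl.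
rewrite (muleC M%:E).
have /fineK <- : (P A * M%:E)%E \is a fin_num by rewrite fin_numM ?fin_num_measure.
have /fineK <- : (\int[P]_(w in A) (f (Y w))%:E)%E \is a fin_num.
  by apply: integrable_fin_num => //; exact: int.
have /fineK <- : (P A * \int[P]_x (f (Y x))%:E)%E \is a fin_num.
  rewrite fin_numM ?fin_num_measure//.
  by apply: integrable_fin_num => //; exact: int.
by rewrite -!EFinD => -[/addIr ->].
Qed.

(** A set of sigma(X) is a union of atoms {X = n}, so the defining equation need only be checked on
    atoms, where [g (X w)] is constant. The conditional pgf, mean and variance all go through
    this. *)
Lemma cond_expectation_fibers X (Y' : T -> R) (g : nat -> R) :
  measurable_fun setT X -> P.-integrable setT (EFin \o Y') ->
  P.-integrable setT (fun w => (g (X w))%:E) ->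
  (forall i, \int[P]_(w in X @^-1` [set i]) (Y' w)%:E =
             (g i)%:E * P (X @^-1` [set i]))%E ->
  is_cond_expectation P (sigma_rv X) Y' (fun w => g (X w)).
Proof.
move=> mX iY ig h; split => //.
  move=> B mB; exists (g @^-1` B) => //.
  by rewrite setTI.
move=> A [C _ <-]; rewrite setTI.
have mC : measurable (X @^-1` C) by exact: measurable_preimage_nat.
apply: (eq_integral_fibers mX) => //.
- by apply: integrableS ig.
- by apply: integrableS iY.
move=> n; case: (pselect (C n)) => Cn; last first.
  rewrite (_ : _ `&` _ = set0) ?integral_set0//.
  by rewrite -subset0 => w [/= ? e]; apply: Cn; rewrite -e.
rewrite (_ : _ `&` _ = X @^-1` [set n]); last first.
  by apply/seteqP; split => [w []//|w /= e]; split => //=; rewrite e.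
rewrite h; apply: integral_fiber_cst; first exact: measurable_preimage_nat.
by move=> w /= ->.
Qed.

End DiscreteExpectation.

(** * The pgf of a finite sum of independent variables *)

Section IndependentSums.
Context {d : measure_display} {T : measurableType d} {R : realType}
  (P : probability T R) {I : eqType} (Z : I -> T -> nat).
Hypothesis mZ : forall i, measurable_fun setT (Z i).
Hypothesis indZ : mutually_independent P Z.

Let event (J : seq I) (B : I -> set nat) : set T :=
  \bigcap_(i in [set` J]) Z i @^-1` B i.

Lemma measurable_event J B : measurable (event J B).
Proof.
elim: J => [|k J IH].
  by rewrite (_ : event _ _ = setT) //; apply/seteqP; split.
rewrite (_ : event _ _ = event J B `&` Z k @^-1` B k).
  by apply: measurableI => //; exact: measurable_preimage_nat.
apply/seteqP; split => w.
  move=> h; split; last by apply: h; rewrite /= mem_head.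
  by move=> i /= iJ; apply: h; rewrite /= inE iJ orbT.
by move=> [h1 h2] i /=; rewrite inE => /orP[/eqP -> //|iJ]; exact: h1.
Qed.

Lemma event_cons k J B C : k \notin J ->
  event J B `&` Z k @^-1` C = event (k :: J) (fun i => if i == k then C else B i).
Proof.
move=> kJ; apply/seteqP; split => w.
  move=> [h1 h2] i /=; rewrite inE; case: eqP => [-> _ //|_ /= iJ]; exact: h1.
move=> h; split.
  move=> i /= iJ; have /= := h i; rewrite inE iJ orbT => /(_ isT).
  by case: eqP => // ik; move: kJ; rewrite -ik iJ.
by have /= := h k; rewrite inE eqxx => /(_ isT).
Qed.

Lemma indep_event k J B C : uniq (k :: J) ->
  (P (event J B `&` Z k @^-1` C) = P (event J B) * P (Z k @^-1` C))%E.
Proof.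
move=> /= /andP[kJ uJ]; rewrite event_cons//.
rewrite (@indZ (k :: J) _) /= ?kJ//.
rewrite (@indZ J B)// big_cons eqxx muleC; congr (_ * _)%E.
rewrite big_seq [RHS]big_seq; apply: eq_bigr => i iJ.
by case: eqP => // ik; move: kJ; rewrite -ik iJ.
Qed.

(** The event makes the induction on [K] work: the first variable is frozen at a value n and moved
    from the summands to the constraints, so independence is invoked only in its finite-list
    form. *)
Lemma pgf_indep_sum (s : R) (c : I -> R) (K J : seq I) B :
  `|s| <= 1 -> (forall i, i \in K -> 'E_P[fun w => (s ^+ Z i w)%R] = (c i)%:E)%E ->
  uniq (K ++ J) ->
  (\int[P]_(w in event J B) (s ^+ (\sum_(k <- K) Z k w)%N)%:E =
   (\prod_(k <- K) c k)%:E * P (event J B))%E.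
Proof.
move=> s1; elim: K J B => [|k K IH] J B hc uKJ.
  rewrite big_nil; apply: integral_fiber_cst; first exact: measurable_event.
  by move=> w _; rewrite big_nil.
have sn n : `|s ^+ n| <= 1 by rewrite normrX exprn_ile1.
have mS : measurable_fun setT (fun w => (\sum_(k <- K) Z k w)%N).
  exact: measurable_nat_sum.
have mS' : measurable_fun setT (fun w => (\sum_(k <- k :: K) Z k w)%N).
  exact: measurable_nat_sum.
have mE := measurable_event J B.
pose p := \prod_(k <- K) c k.
(* On each fiber {Z_k = n} the induction hypothesis replaces the remaining sum by [p]; afterwards
   [Z k] is integrated out, being independent of the event. *)
transitivity (\int[P]_(w in event J B) ((fun n => p * s ^+ n) (Z k w))%:E)%E.
  apply: (eq_integral_fibers (mZ k)) => //.
  - exact: (bounded_comp_integrable P mS' mE sn).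
  - apply: (bounded_comp_integrable (f := fun n => p * s ^+ n) (M := `|p|) P (mZ k) mE) => n.
    by rewrite normrM ler_piMr.
  move=> n; have mF := measurable_fiber n (mZ k) mE.
  rewrite (@integral_fiber_cst _ _ _ _ (fun w => (p * s ^+ Z k w)%:E) _ (p * s ^+ n))//;
    last by move=> w [_ /= ->].
  transitivity (\int[P]_(w in event J B `&` Z k @^-1` [set n])
      ((s ^+ n)%:E * (s ^+ (\sum_(k <- K) Z k w)%N)%:E))%E.
    apply: eq_integral => w /set_mem [_ /= <-].
    by rewrite big_cons exprD EFinM.
  rewrite integralZl//; last exact: (bounded_comp_integrable P mS mF sn).
  move: uKJ => /=; rewrite mem_cat negb_or => /andP[/andP[kK kJ] uKJ].
  rewrite event_cons// IH.
  - by rewrite muleA -EFinM mulrC.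
  - by move=> i iK; apply: hc; rewrite inE iK orbT.
  - rewrite cat_uniq /= negb_or kK kJ.
    by move: uKJ; rewrite cat_uniq => /and3P[-> -> ->].
under eq_integral do rewrite EFinM.
rewrite integralZl//; last exact: (bounded_comp_integrable P (mZ k) mE sn).
rewrite (integral_indep (M := 1) (mZ k))//; last first.
  move=> C; apply: indep_event => /=.
  move: uKJ => /=; rewrite mem_cat negb_or => /andP[/andP[_ ->]].
  by rewrite cat_uniq => /and3P[_ _ ->].
have := hc k (mem_head _ _); rewrite unlock => ->.
by rewrite big_cons muleCA muleC -EFinM mulrC.
Qed.

End IndependentSums.

(** Makes the one-step identity iterable, its new argument staying in [-1, 1]: with u = 1 - s the
    denominator is at least 1, so the fraction lies between 0 and u <= 2. *)
Lemma thinning_pgf_norm (R : realType) (alpha mu r s : R) :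
  0 < alpha < 1 -> 0 < mu -> 0 < r -> `|s| <= 1 ->
  `|thinning_pgf alpha mu r s| <= 1.
Proof.
move=> /andP[a0 a1] mu0 r0; rewrite ler_norml => /andP[s0 s1].
rewrite /thinning_pgf; set u := 1 - s.
have hD : 1 <= 1 + r^-1 * (1 - alpha) * mu * u.
  by rewrite lerDl !mulr_ge0 ?invr_ge0 ?subr_ge0 ?(ltW r0) ?(ltW mu0) ?(ltW a1).
set D := 1 + _ in hD *.
have D0 : 0 < D by lra.
have h1 : 0 <= u / D by rewrite divr_ge0 ?(ltW D0) ?subr_ge0.
have h2 : u / D <= u.
  by rewrite ler_pdivrMr// ler_peMr// subr_ge0.
have h3 : u <= 2 by rewrite /u; lra.
by rewrite ler_norml; apply/andP; split; nra.
Qed.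

(** * From one step of the process to h steps *)

Section Branching.
Context {d : measure_display} {T : measurableType d} {R : realType}
  (P : probability T R) (alpha mu r : R) (X : nat -> {RV P >-> nat})
  (G : nat -> nat -> {RV P >-> nat}) (eps : nat -> {RV P >-> nat}).
Hypotheses (alpha01 : 0 < alpha < 1) (mu_gt0 : 0 < mu) (r_gt0 : 0 < r).
Hypothesis HX : INAR1 alpha mu r X G eps.
Hypothesis epsNB : forall t, NB_distributed P (eps t.+1) r ((1 - alpha) * mu).

Let Z t (o : option nat) : T -> nat := noise G eps (t, o).

Lemma measurable_noise t o : measurable_fun setT (Z t o).
Proof. by rewrite /Z /noise; case: o => [i|] /=; exact: measurable_funPT. Qed.

Lemma indep_noise t : mutually_independent P (Z t).
Proof.
move=> J B uJ.
have uJ' : uniq [seq (t, o) | o <- J] by rewrite map_inj_uniq// => o o' [].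
have := @INAR1_noise _ _ _ _ _ _ _ _ _ _ HX _ (fun k => B k.2) uJ'.
rewrite big_map => <-; congr (P _); apply/seteqP; split => w h.
  by move=> k /= /mapP [v vJ ->]; exact: h.
by move=> o /= oJ; apply: (h (t, o)); apply/mapP; exists o.
Qed.

(** The population size is frozen at n: on {X_t = n} this is X_{t+1}, and as a fixed finite sum of
    noise variables of step t it is independent of the past. *)
Let offspring t n w : nat := (\sum_(o <- None :: map Some (index_iota 0 n)) Z t o w)%N.

Lemma INAR1_rec_offspring t w : X t.+1 w = offspring t (X t w) w.
Proof.
rewrite (INAR1_rec HX) /thinning /offspring big_cons big_map addnC.
by rewrite big_mkord.
Qed.

Lemma past_indep_offspring u t i n B : (u <= t)%N ->
  let A := X u @^-1` [set i] `&` X t @^-1` [set n] in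
  (P (A `&` offspring t n @^-1` B) = P A * P (offspring t n @^-1` B))%E.
Proof.
move=> ut A; apply: (INAR1_past HX).
- have H v j : (v <= t)%N -> sigma_family [set s | (s <= t)%N] X (X v @^-1` [set j]).
    move=> vt; apply: sub_sigma_algebra; exists v => //.
    by exists [set j] => //; rewrite setTI.
  have := @measurableI _ (g_sigma_algebraType
    (\bigcup_(i in [set s | (s <= t)%N]) sigma_rv (X i))) _ _ (H u i ut) (H t n (leqnn t)).
  exact.
- pose S := \bigcup_(k in [set k | k.1 = t]) sigma_rv (noise G eps k).
  have mZ o : measurable_fun [set: g_sigma_algebraType S]
      (Z t o : g_sigma_algebraType S -> nat).
    move=> _ C mC; rewrite setTI; apply: sub_sigma_algebra.
    by exists (t, o) => //; exists C => //; rewrite setTI.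
  have := @measurable_nat_sum _ (g_sigma_algebraType S) _
    (None :: map Some (index_iota 0 n)) (Z t) mZ measurableT B.
  by rewrite setTI; exact.
Qed.

Let kappa s := NB_pgf r ((1 - alpha) * mu) s.
Let psi s := thinning_pgf alpha mu r s.

Lemma pgf_offspring t n s : `|s| <= 1 ->
  (\int[P]_w (s ^+ offspring t n w)%:E = (kappa s * psi s ^+ n)%:E)%E.
Proof.
move=> s1.
have := @pgf_indep_sum _ _ _ P _ (Z t) (measurable_noise t) (@indep_noise t)
  s (fun o => if o is Some _ then psi s else kappa s)
  (None :: map Some (index_iota 0 n)) [::] (fun=> setT) s1.
rewrite set_nil bigcap_set0 probability_setT mule1 cats0 => ->.
- rewrite big_cons big_map prodr_const_nat subn0.
  by [].
- case=> [i|] _ /=; first exact: (INAR1_counting HX).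
  exact: epsNB.
- rewrite cons_uniq map_inj_uniq; last by move=> ? ? [].
  by rewrite iota_uniq andbT; apply/mapP => -[].
Qed.

(** The event sits at a time u possibly earlier than t, since the iteration keeps conditioning on
    the initial atom while the steps move on. Cutting further by the atoms of X_t allows [offspring]
    to replace X_{t+1}. *)
Lemma one_step u t i s : `|s| <= 1 -> (u <= t)%N ->
  (\int[P]_(w in X u @^-1` [set i]) (s ^+ X t.+1 w)%:E =
   (kappa s)%:E * \int[P]_(w in X u @^-1` [set i]) (psi s ^+ X t w)%:E)%E.
Proof.
move=> s1 ut.
have sn n : `|s ^+ n| <= 1 by rewrite normrX exprn_ile1.
have p1 : `|psi s| <= 1 by exact: thinning_pgf_norm.
have pn n : `|psi s ^+ n| <= 1 by rewrite normrX exprn_ile1.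
have mX v : measurable_fun setT (X v) by exact: measurable_funPT.
have mA : measurable (X u @^-1` [set i]) by exact: measurable_preimage_nat.
have ipsi : P.-integrable (X u @^-1` [set i]) (fun w => (psi s ^+ X t w)%:E).
  exact: (bounded_comp_integrable P (mX t) mA pn).
rewrite -integralZl//.
apply: (eq_integral_fibers (mX t)) => //.
- exact: (bounded_comp_integrable P (mX t.+1) mA sn).
- exact: integrableZl.
move=> n; have mF := measurable_fiber n (mX t) mA.
rewrite [RHS](integral_fiber_cst P (c := kappa s * psi s ^+ n) mF); last first.
  by move=> w [_ /= ->].
transitivity (\int[P]_(w in X u @^-1` [set i] `&` X t @^-1` [set n])
    (s ^+ offspring t n w)%:E)%E.
  apply: eq_integral => w /set_mem [_ /= e].
  by rewrite INAR1_rec_offspring e.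
rewrite (@integral_indep _ _ _ P (offspring t n) (fun m => s ^+ m) 1)//.
- by rewrite pgf_offspring// muleC.
- by apply: measurable_nat_sum; exact: measurable_noise.
- by move=> B; exact: past_indep_offspring.
Qed.

(** The last step is peeled off and the induction hypothesis is used at the thinning pgf of s
    instead of s; the two closed forms then combine by the semigroup law. *)
Lemma h_step t i h s : `|s| <= 1 ->
  (\int[P]_(w in X t @^-1` [set i]) (s ^+ X (t + h)%N w)%:E =
   (thinning_pgf (alpha ^+ h) mu r s ^+ i *
    NB_pgf r ((1 - alpha ^+ h) * mu) s)%:E * P (X t @^-1` [set i]))%E.
Proof.
elim: h s => [|h IH] s s1.
  rewrite addn0; apply: integral_fiber_cst.
    by apply: measurable_preimage_nat; exact: measurable_funPT.
  move=> w /= ->; rewrite expr0 /thinning_pgf /NB_pgf subrr !mulr0 !mul0r.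
  by rewrite addr0 divr1 mul1r opprB addrC subrK powR1 mulr1.
rewrite addnS one_step ?leq_addr// IH; last exact: thinning_pgf_norm.
rewrite muleA -EFinM; congr (_%:E * _)%E.
move: s1; rewrite ler_norml => /andP[s0 s1].
have u0 : 0 <= 1 - s by rewrite subr_ge0.
move/andP: (alpha01) => [a0 a1].
have b0 : 0 < alpha ^+ h by rewrite exprn_gt0.
have b1 : alpha ^+ h <= 1 by apply: exprn_ile1; exact: ltW.
have ri : 0 < r^-1 by rewrite invr_gt0.
rewrite /kappa /psi exprSr; set b := alpha ^+ h in b0 b1 *.
pose u := 1 - s.
have [m [m0 mE]] : exists m, 0 < m /\ mu / r = m by exists (mu / r); rewrite divr_gt0.
have mE' x : r^-1 * x * mu = x * m by rewrite -mE; ring.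
have mE2 x : x * mu / r = x * m by rewrite -mulrA mE.
have D1 : 0 < 1 + (1 - alpha) * m * u.
  by rewrite ltr_pwDl// !mulr_ge0// ?subr_ge0 ltW.
have D2 : 0 < 1 + (1 - b * alpha) * m * u.
  rewrite ltr_pwDl// !mulr_ge0// ?subr_ge0 ?(ltW m0)//.
  by apply: le_trans (ltW a1); rewrite ler_piMl// ltW.
have e1 : 1 - thinning_pgf alpha mu r s = alpha * u / (1 + (1 - alpha) * m * u).
  by rewrite /thinning_pgf -/u opprB addrC subrK mulrA mE'.
have e2 : thinning_pgf b mu r (thinning_pgf alpha mu r s) =
    thinning_pgf (b * alpha) mu r s.
  rewrite [LHS]/thinning_pgf e1 [RHS]/thinning_pgf -/u.
  rewrite !mE'; congr (1 - _).
  (* This quotient serves twice: it gives the composition law of the thinning pgfs, and its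
     denominator cancels against the innovation pgf in the product of NB pgfs. *)
  have D3 : 1 + (1 - b) * m * (alpha * u / (1 + (1 - alpha) * m * u)) =
    (1 + (1 - b * alpha) * m * u) / (1 + (1 - alpha) * m * u).
    by field; rewrite gt_eqF.
  by rewrite D3; field; rewrite !gt_eqF.
rewrite e2 mulrCA; congr (_ * _).
rewrite /NB_pgf e1 -powRM.
- congr (_ `^ _); rewrite -/u.
  by rewrite !mE2; field; rewrite gt_eqF.
- by rewrite mE2 ltW.
- rewrite mE2 addr_ge0// mulr_ge0//.
    by rewrite mulr_ge0 ?subr_ge0// ltW.
  by rewrite divr_ge0 ?(ltW D1)// mulr_ge0// ltW.
Qed.

End Branching.

(** * First and second moments from the expansion of a pgf at 1 *)

Lemma expansion_trans (R : realType) n (f : R -> R) (p q : {poly R}) :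
  expansion n f p -> expansion n (horner p) q -> expansion n f q.
Proof.
move=> [C hC] [D hD]; exists (C + D) => s hs; rewrite mulrDl.
apply: le_trans (lerD (hC s hs) (hD s hs)).
by apply: le_trans (ler_normD _ _); rewrite addrA subrK.
Qed.

Lemma expansion_take_poly (R : realType) n (f : R -> R) (p : {poly R}) :
  expansion n f p -> expansion n f (take_poly n p).
Proof.
move=> hf; apply: (expansion_trans hf).
have [M hM] := horner_bounded (drop_poly n p).
exists M => s hs; rewrite -[X in `|X.[s] - _|](poly_take_drop n p).
rewrite hornerD addrAC subrr add0r hornerM hornerXn normrM.
case/andP: (hs) => s0 _; rewrite (ger0_norm (exprn_ge0 _ (ltW s0))).
by apply: ler_wpM2r; [exact: exprn_ge0 (ltW s0) | exact: hM].
Qed.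

Section Moments.
Context {d : measure_display} {T : measurableType d} {R : realType}
  (P : probability T R) (Y : T -> nat) (A : set T).
Hypotheses (mY : measurable_fun setT Y) (mA : measurable A).

(** Decreases to 0 inside the range (0, 1/2] of [expansion]; the moments are limits at s = 1 -
    u_m. *)
Let u (m : nat) : R := m.+2%:R^-1.

Lemma cvg_rate (x : nat -> R) l K :
  (forall m, `|x m - l| <= K * u m) -> x @ \oo --> l.
Proof.
move=> hx.
have u0 : u @ \oo --> (0 : R).
  by have := @cvg_harmonic R; rewrite -(cvg_shiftS (@harmonic R)).
have Ku : (fun m => K * u m) @ \oo --> (0 : R).
  by rewrite -(mulr0 K); apply: cvgMr.
apply: (@squeeze_cvgr _ _ _ _ (fun m => l - K * u m) (fun m => l + K * u m)).
- by apply: nearW => m; have := hx m; rewrite ler_norml => /andP[h1 h2]; lra.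
- by rewrite -[X in _ --> X]subr0; apply: cvgB => //; exact: cvg_cst.
- by rewrite -[X in _ --> X]addr0; apply: cvgD => //; exact: cvg_cst.
Qed.

Lemma horner_ge0 (p : {poly R}) s : (forall k, 0 <= p`_k) -> 0 <= s -> 0 <= p.[s].
Proof.
by move=> p0 s0; rewrite horner_coef sumr_ge0// => k _; rewrite mulr_ge0 ?exprn_ge0.
Qed.

Lemma horner_nondecreasing (p : {poly R}) s t :
  (forall k, 0 <= p`_k) -> 0 <= s -> s <= t -> p.[s] <= p.[t].
Proof.
move=> p0 s0 st; rewrite !horner_coef; apply: ler_sum => k _.
by apply: ler_wpM2l => //; rewrite lerXn2r ?nnegrE// (le_trans s0).
Qed.

Lemma u_itv m : 0 < u m <= 2^-1.
Proof. by rewrite invr_gt0 ltr0n /= lef_pV2 ?posrE// ler_nat. Qed.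

(** Nonnegative coefficients make the integrands increase with s, so monotone convergence applies
    without an integrability assumption at s = 1. *)
Lemma integral_horner_limit (q : nat -> {poly R}) (a : nat -> R) l :
  (forall n k, 0 <= (q n)`_k) ->
  (forall m, \int[P]_(w in A) ((q (Y w)).[1 - u m])%:E = (a m)%:E)%E ->
  a @ \oo --> l ->
  (\int[P]_(w in A) ((q (Y w)).[1])%:E = l%:E)%E.
Proof.
move=> q0 ha al.
have s0 m : 0 <= 1 - u m by have := u_itv m; lra.
have mq s : measurable_fun setT (fun w => (q (Y w)).[s]).
  exact: (measurable_comp_nat (fun n => (q n).[s]) mY).
have cv n : (q n).[1 - u m] @[m --> \oo] --> (q n).[1].
  apply: (@continuous_cvg _ _ _ _ _ (fun m => 1 - u m)).
    exact: continuous_horner.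
  apply: (@cvg_rate _ _ 1) => m.
  by rewrite addrC addrA addNr add0r normrN mul1r ger0_norm// ltW//; case/andP: (u_itv m).
have H : (\int[P]_(w in A) ((q (Y w)).[1 - u m])%:E)%E @[m --> \oo] -->
    (\int[P]_(w in A) limn (fun m => ((q (Y w)).[1 - u m])%:E))%E.
  apply: cvg_monotone_convergence => //.
  - by move=> m; apply: measurable_funTS; apply/measurable_EFinP; exact: mq.
  - by move=> m w _; rewrite lee_fin horner_ge0.
  - move=> w _ m n mn; rewrite lee_fin; apply: horner_nondecreasing => //.
    by rewrite lerD2l lerN2 lef_pV2 ?posrE// ler_nat.
rewrite (eq_integral (fun w => limn (fun m => ((q (Y w)).[1 - u m])%:E))); last first.
  move=> w _; apply/esym/cvg_lim => //; apply: cvg_EFin; first exact: nearW.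
  exact: cv.
have H' : (\int[P]_(w in A) ((q (Y w)).[1 - u m])%:E)%E @[m --> \oo] --> l%:E.
  by under eq_fun do rewrite ha; apply: cvg_EFin => //; exact: nearW.
exact: (cvg_unique _ H H').
Qed.

Lemma ge0_integrable (f : nat -> R) (l : R) : (forall n, 0 <= f n) ->
  (\int[P]_(w in A) (f (Y w))%:E = l%:E)%E ->
  P.-integrable A (fun w => (f (Y w))%:E).
Proof.
move=> f0 fl; apply/integrableP; split.
  apply: measurable_funTS; apply/measurable_EFinP.
  exact: (measurable_comp_nat f mY).
by under eq_integral do rewrite gee0_abs ?lee_fin//; rewrite fl ltry.
Qed.

(** The quotient (1 - s^n)/(1 - s); [geom2] is the next one, (n - geom)/(1 - s). Their integrals at
    s < 1 are difference quotients of the pgf at 1. *)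
Let geom (n : nat) : {poly R} := \sum_(k < n) 'X^k.

Let geom2 (n : nat) : {poly R} := \sum_(k < n) geom k.

Lemma geomE n s : (1 - s) * (geom n).[s] = 1 - s ^+ n.
Proof.
rewrite horner_sum; under eq_bigr do rewrite hornerXn.
by rewrite -opprB mulNr -subrX1 opprB.
Qed.

Lemma geom2E n s : (1 - s) * (geom2 n).[s] = n%:R - (geom n).[s].
Proof.
rewrite horner_sum mulr_sumr; under eq_bigr do rewrite geomE.
rewrite sumrB sumr_const card_ord; congr (_ - _).
by rewrite horner_sum; apply: eq_bigr => k _; rewrite hornerXn.
Qed.

Lemma geom_horner1 n : (geom n).[1] = n%:R.
Proof.
rewrite horner_sum; under eq_bigr do rewrite hornerXn expr1n.
by rewrite sumr_const card_ord.
Qed.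

Lemma geom2_horner1 n : (geom2 n).[1] = 'C(n, 2)%:R.
Proof.
rewrite horner_sum; under eq_bigr do rewrite geom_horner1.
by rewrite -natr_sum -bin2_sum big_mkord.
Qed.

Lemma coef_geom_ge0 n k : 0 <= (geom n)`_k.
Proof. by rewrite coef_sum sumr_ge0// => i _; rewrite coefXn ler0n. Qed.

Lemma coef_geom2_ge0 n k : 0 <= (geom2 n)`_k.
Proof. by rewrite coef_sum sumr_ge0// => i _; exact: coef_geom_ge0. Qed.

Variables (psi : R -> R) (p : {poly R}).
Hypothesis pgfY : forall s, 0 <= s <= 1 ->
  (\int[P]_(w in A) (s ^+ Y w)%:E = (psi s)%:E * P A)%E.
Hypotheses (psi_exp : expansion 3 (fun u => psi (1 - u)) p) (p0 : p`_0 = 1).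

Let a := fine (P A).

Let PA : P A = a%:E.
Proof. by rewrite fineK// fin_num_measure. Qed.

Lemma expansion3 : exists2 C, 0 <= C & forall m,
  `|psi (1 - u m) - (1 + p`_1 * u m + p`_2 * u m ^+ 2)| <= C * u m ^+ 3.
Proof.
have [C hC] := expansion_take_poly psi_exp; exists `|C| => // m.
have := hC _ (u_itv m); rewrite horner_poly !big_ord_recr big_ord0 /=.
rewrite add0r expr0 mulr1 expr1 p0 => /le_trans; apply.
apply: ler_wpM2r; last exact: ler_norm.
by rewrite exprn_ge0// ltW//; case/andP: (u_itv m).
Qed.

Lemma integral_geom m :
  (\int[P]_(w in A) ((geom (Y w)).[1 - u m])%:E =
   (a * ((1 - psi (1 - u m)) / u m))%:E)%E.
Proof.
case/andP: (u_itv m) => um0 um1.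
have s01 : 0 <= 1 - u m <= 1 by lra.
under eq_integral => w _.
  rewrite (_ : (geom (Y w)).[1 - u m] = (u m)^-1 * (1 - (1 - u m) ^+ Y w)); last first.
    by rewrite -geomE subKr mulKf// gt_eqF.
  rewrite EFinM EFinB; over.
have sn n : `|(1 - u m) ^+ n| <= 1.
  by rewrite normrX exprn_ile1// ger0_norm//; case/andP: s01.
have i1 : P.-integrable A (fun w => ((1 - u m) ^+ Y w)%:E).
  exact: (bounded_comp_integrable P mY mA sn).
have i2 : P.-integrable A (fun=> 1%:E).
  apply: (bounded_comp_integrable (f := cst 1) (M := 1) P mY mA) => n.
  by rewrite normr1.
rewrite integralZl//; last exact: integrableB.
have e1 : (\int[P]_(w in A) 1%:E = a%:E)%E.
  by rewrite integral_cst// mul1e -PA.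
by rewrite integralB// e1 pgfY// PA -EFinM; congr EFin; ring.
Qed.

(** The expansion is in u = 1 - s, hence the sign: (1 - psi(1 - u))/u tends to minus the linear
    coefficient. *)
Lemma integral_mean : (\int[P]_(w in A) (Y w)%:R%:E = (- p`_1)%:E * P A)%E.
Proof.
rewrite PA -EFinM; under eq_integral do rewrite -geom_horner1.
apply: integral_horner_limit integral_geom _; first exact: coef_geom_ge0.
have [C C0 hC] := expansion3.
apply: (@cvg_rate _ _ (`|a| * (`|p`_2| + C))) => m.
case/andP: (u_itv m) => um0 um1.
have -> : a * ((1 - psi (1 - u m)) / u m) - - p`_1 * a =
  - a * ((psi (1 - u m) - (1 + p`_1 * u m + p`_2 * u m ^+ 2)) / u m + p`_2 * u m).
  by field; rewrite gt_eqF.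
rewrite normrM normrN -mulrA; apply: ler_wpM2l => //.
apply: le_trans (ler_normD _ _) _; rewrite addrC [leRHS]mulrDl.
rewrite normrM (ger0_norm (ltW um0)) lerD2l normrM normfV (ger0_norm (ltW um0)).
rewrite ler_pdivrMr//; apply: le_trans (hC m) _.
rewrite -mulrA -expr2; apply: ler_wpM2l => //.
by rewrite ler_wiXn2l//; lra.
Qed.

Lemma integrable_mean : P.-integrable A (fun w => (Y w)%:R%:E).
Proof.
apply: (@ge0_integrable (fun n => n%:R) (- p`_1 * a)) => //.
by rewrite integral_mean PA EFinM.
Qed.

Lemma integral_bin2 : (\int[P]_(w in A) 'C(Y w, 2)%:R%:E = (p`_2)%:E * P A)%E.
Proof.
rewrite PA -EFinM; under eq_integral do rewrite -geom2_horner1.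
pose b m := a * ((- p`_1 - (1 - psi (1 - u m)) / u m) / u m).
apply: (@integral_horner_limit geom2 b) => [n k|m|]; first exact: coef_geom2_ge0.
  case/andP: (u_itv m) => um0 um1.
  under eq_integral => w _.
    rewrite (_ : (geom2 (Y w)).[1 - u m] =
        (u m)^-1 * ((Y w)%:R - (geom (Y w)).[1 - u m])); last first.
      by rewrite -geom2E subKr mulKf// gt_eqF.
    rewrite EFinM EFinB; over.
  have i1 : P.-integrable A (fun w => ((geom (Y w)).[1 - u m])%:E).
    apply: (ge0_integrable (f := fun n => (geom n).[1 - u m])) (integral_geom m).
    by move=> n; apply: horner_ge0; [exact: coef_geom_ge0 | lra].
  rewrite integralZl//; last by apply: integrableB => //; exact: integrable_mean.
  rewrite integralB//; last exact: integrable_mean.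
  rewrite integral_mean integral_geom PA -EFinM /b.
  by congr EFin; ring.
have [C C0 hC] := expansion3.
(* Two divisions by u turn the remainder C u^3 into C u; this fixes the order 3 of the expansion. *)
apply: (@cvg_rate _ _ (`|a| * C)) => m.
case/andP: (u_itv m) => um0 um1.
have -> : b m - p`_2 * a =
  a * ((psi (1 - u m) - (1 + p`_1 * u m + p`_2 * u m ^+ 2)) / u m ^+ 2).
  by rewrite /b; field; rewrite gt_eqF.
rewrite normrM -mulrA; apply: ler_wpM2l => //.
have u2 : 0 < u m ^+ 2 by rewrite exprn_gt0.
rewrite normrM normfV (ger0_norm (ltW u2)) ler_pdivrMr//.
by rewrite -mulrA -exprS; exact: hC.
Qed.

Lemma integrable_bin2 : P.-integrable A (fun w => 'C(Y w, 2)%:R%:E).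
Proof.
apply: (@ge0_integrable (fun n => 'C(n, 2)%:R) (p`_2 * a)) => //.
by rewrite integral_bin2 PA EFinM.
Qed.

Lemma integrable_quadratic c0 c1 c2 :
  P.-integrable A (fun w => (c0 + c1 * (Y w)%:R + c2 * 'C(Y w, 2)%:R)%:E).
Proof.
have ic : P.-integrable A (fun=> c0%:E).
  exact: (bounded_comp_integrable (f := cst c0) (M := `|c0|) P mY mA).
under eq_fun do rewrite EFinD (EFinD c0) 2!EFinM.
apply: integrableD => //; last by apply: integrableZl => //; exact: integrable_bin2.
by apply: integrableD => //; apply: integrableZl => //; exact: integrable_mean.
Qed.

Lemma integral_quadratic c0 c1 c2 :
  (\int[P]_(w in A) (c0 + c1 * (Y w)%:R + c2 * 'C(Y w, 2)%:R)%:E =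
   (c0 - c1 * p`_1 + c2 * p`_2)%:E * P A)%E.
Proof.
have ic : P.-integrable A (fun=> c0%:E).
  exact: (bounded_comp_integrable (f := cst c0) (M := `|c0|) P mY mA).
have i1 : P.-integrable A (fun w => (c1%:E * (Y w)%:R%:E)%E).
  by apply: integrableZl => //; exact: integrable_mean.
have i2 : P.-integrable A (fun w => (c2%:E * 'C(Y w, 2)%:R%:E)%E).
  by apply: integrableZl => //; exact: integrable_bin2.
under eq_integral do rewrite EFinD (EFinD c0) 2!EFinM.
rewrite integralD//; last exact: integrableD.
have e0 : (\int[P]_(w in A) c0%:E = (c0 * a)%:E)%E.
  by rewrite integral_cst// EFinM -PA.
rewrite integralD// e0.
rewrite integralZl//; last exact: integrable_mean.
rewrite integralZl//; last exact: integrable_bin2.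
by rewrite integral_mean integral_bin2 PA -!EFinM; congr EFin; ring.
Qed.

End Moments.

(** * Point probabilities as coefficients of a pgf at 0 *)

Lemma expansion_pgf {d : measure_display} {T : measurableType d} {R : realType}
    (P : probability T R) (Y : T -> nat) (A : set T) (psi : R -> R) n :
  measurable_fun setT Y -> measurable A ->
  (forall s, 0 <= s <= 1 ->
    (\int[P]_(w in A) (s ^+ Y w)%:E = (psi s)%:E * P A)%E) ->
  expansion n (fun s => psi s * fine (P A))
    (\poly_(j < n) fine (P (A `&` Y @^-1` [set j]))).
Proof.
move=> mY mA pgfY; exists 1 => s /andP[s0 s1].
have s01 : 0 <= s <= 1 by lra.
have s_le1 k : s ^+ k <= 1 by rewrite exprn_ile1//; lra.
have sk0 k : 0 <= s ^+ k by rewrite exprn_ge0// ltW.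
pose D m := A `&` Y @^-1` [set k | (m <= k)%N].
have mD m : measurable (D m) by apply: measurableI => //; exact: measurable_preimage_nat.
have msY B : measurable_fun B (fun w => (s ^+ Y w)%:E).
  apply: measurable_funTS; apply/measurable_EFinP.
  exact: (measurable_comp_nat (fun k => s ^+ k) mY).
(* The atoms Y = 0, ..., m - 1 are split off one at a time. On the remaining set {Y >= n} the
   integrand is at most s^n, so the remainder constant is 1. *)
have H m : (\int[P]_(w in A) (s ^+ Y w)%:E =
    (\sum_(j < m) fine (P (A `&` Y @^-1` [set (j : nat)])) * s ^+ j)%:E +
    \int[P]_(w in D m) (s ^+ Y w)%:E)%E.
  elim: m => [|m ->].
    rewrite big_ord0 add0e; congr (integral _ _ _).
    by apply/seteqP; split => [w|w []].
  rewrite big_ord_recr /= EFinD -addeA; congr (_ + _)%E.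
  rewrite EFinM fineK ?fin_num_measure//; last exact: measurable_fiber.
  rewrite muleC -(@integral_fiber_cst _ _ _ P (fun w => (s ^+ Y w)%:E)); last 2 first.
  - exact: measurable_fiber.
  - by move=> w [_ /= ->].
  rewrite -ge0_integral_setU//.
  - congr (integral _ _ _); apply/seteqP; split => w.
      move=> [Aw /=]; rewrite leq_eqVlt => /orP[/eqP <-|h]; first by left.
      by right.
    by move=> [[Aw /= e]|[Aw /= h]]; split => //=; rewrite ?e// ltnW.
  - exact: measurable_fiber.
  - by move=> w _; rewrite lee_fin.
  - apply/disj_setPS => w [[_ /= e] [_ /=]].
    by rewrite e ltnn.
rewrite horner_poly; have := H n.
rewrite pgfY// -{1}(fineK (fin_num_measure P _ mA)) -EFinM.
have i0 : (0 <= \int[P]_(w in D n) (s ^+ Y w)%:E)%E.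
  by apply: integral_ge0 => w _; rewrite lee_fin.
have i1 : (\int[P]_(w in D n) (s ^+ Y w)%:E <= (s ^+ n)%:E)%E.
  apply: (@le_trans _ _ (\int[P]_(w in D n) (s ^+ n)%:E)%E).
    apply: ge0_le_integral => //; [by move=> w _; rewrite lee_fin..|].
    move=> w [_ /= nY]; rewrite lee_fin.
    by rewrite ler_wiXn2l//; lra.
  rewrite integral_cst// -[leRHS]mule1; apply: lee_wpmul2l.
    by rewrite lee_fin.
  exact: probability_le1.
have ifin : (\int[P]_(w in D n) (s ^+ Y w)%:E)%E \is a fin_num.
  by rewrite ge0_fin_numE// (le_lt_trans i1)// ltry.
move: i0 i1; rewrite -(fineK ifin) !lee_fin -EFinD => i0 i1 [->].
by rewrite addrAC subrr add0r ger0_norm// mul1r.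
Qed.

Section Weights.
Context {R : realType}.
Implicit Types (q r x s : R).

(** The quotient Gamma(j + r) / (Gamma(r) Gamma(j + 1)) is the binomial series coefficient, so these
    weights are the coefficients of (q / (1 - (1 - q) s))^r. *)
Lemma negbinomial_weightE r q j : 0 < r -> q < 1 ->
  negbinomial_weight (j%:R + r) r q =
  q `^ r * (rising r j / j`!%:R * (1 - q) ^+ j).
Proof.
move=> r0 q1; rewrite /negbinomial_weight addrK natr1 Gamma_fact.
rewrite (addrC j%:R) Gamma_rising// powR_mulrn; last by lra.
have g0 := Gamma_gt0 r0.
have f0 : (j`!%:R : R) != 0 by rewrite pnatr_eq0 -lt0n fact_gt0.
by field; rewrite f0 gt_eqF.
Qed.

Lemma inv_powR x r : 0 < x -> x^-1 `^ r = x `^ (- r).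
Proof. by move=> x0; rewrite -powR_inv1 ?ltW// -powRrM mulN1r. Qed.

Lemma expansion_negbin_pgf n r q : 0 < r -> 0 < q -> q < 1 ->
  expansion n (fun s => (q / (1 - (1 - q) * s)) `^ r)
    (q `^ r *: negbin_poly n r (1 - q)).
Proof.
move=> r0 q0 q1.
apply: (@expansion_ext _ _ (fun s => q `^ r * (1 - (1 - q) * s) `^ (- r))).
  move=> s /andP[s0 s1].
  have D0 : 0 < 1 - (1 - q) * s by nra.
  by rewrite powRM ?ltW ?invr_gt0// inv_powR.
by apply: expansionZ; apply: expansion_negbin => //; lra.
Qed.

(** Truncated pgf of the number of trials up to the l-th success. The case l = 0 stands apart
    because [expansion_negbin] asks for a positive exponent. *)
Definition success_poly n q l : {poly R} :=
  if l is 0%N then 1 else q ^+ l *: ('X^l * negbin_poly n l%:R (1 - q)).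

Lemma expansion_success n q l : 0 < q -> q < 1 ->
  expansion n (fun s => (q * s / (1 - (1 - q) * s)) ^+ l) (success_poly n q l).
Proof.
move=> q0 q1; case: l => [|l].
  apply: (@expansion_ext _ _ (horner 1)) => [s _|]; last exact: expansion_horner.
  by rewrite hornerE.
apply: (@expansion_ext _ _ (fun s =>
    q ^+ l.+1 * (('X^(l.+1)).[s] * (1 - (1 - q) * s) `^ (- l.+1%:R)))).
  move=> s /andP[s0 s1].
  have D0 : 0 < 1 - (1 - q) * s by nra.
  by rewrite hornerXn powR_invn ?(ltW D0)// !exprMn exprVn mulrA.
apply: expansionZ; apply: expansionM; first exact: expansion_horner.
by apply: expansion_negbin; [rewrite ltr0n | lra].
Qed.

Lemma coef_success n q l k : 0 < q -> q < 1 -> (0 < l)%N -> (k < n)%N ->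
  (success_poly n q l)`_k = if (l <= k)%N then negbinomial_weight k%:R l%:R q else 0.
Proof.
case: l => // l q0 q1 _ kn; rewrite /success_poly coefZ coefXnM.
rewrite [(k < l.+1)%N]ltnS; case: (ltnP l k) => lk; last by rewrite mulr0.
rewrite coef_poly (leq_ltn_trans (leq_subr _ _) kn).
have -> : k%:R = (k - l.+1)%:R + l.+1%:R :> R by rewrite -natrD subnK.
by rewrite negbinomial_weightE ?ltr0n// powR_mulrn ?ltW.
Qed.

(** A counting variable is 0 with probability 1 - y and otherwise geometric on {1, 2, ...}: its pgf
    is (1 - y) + y q s / (1 - (1 - q) s). The index l counts the individuals, among i, with nonzero
    offspring. *)
Definition thinning_poly n i y q : {poly R} :=
  \sum_(l < i.+1) binomial_weight i l y *: success_poly n q l.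

Lemma expansion_thinning n i y q : 0 < q -> q < 1 ->
  expansion n (fun s => (1 - y * ((1 - s) / (1 - (1 - q) * s))) ^+ i)
    (thinning_poly n i y q).
Proof.
move=> q0 q1.
apply: (@expansion_ext _ _ (fun s => \sum_(l < i.+1)
    binomial_weight i l y * (q * s / (1 - (1 - q) * s)) ^+ l)).
  move=> s /andP[s0 s1].
  have D0 : 0 < 1 - (1 - q) * s by nra.
  have -> : 1 - y * ((1 - s) / (1 - (1 - q) * s)) =
      (1 - y) + y * (q * s / (1 - (1 - q) * s)) by field; rewrite gt_eqF.
  rewrite exprDn; apply: eq_bigr => l _.
  rewrite [(y * _) ^+ _]exprMn -[RHS]mulr_natl /binomial_weight !mulrA.
  by congr (_ * _); exact: mulrAC.
apply: expansion_sum => l; apply: expansionZ.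
exact: expansion_success.
Qed.

(** The term l = 0 is constant and counts only at k = 0; for k >= 1, l successes need at least l
    trials, which cuts the sum at min(i, k). *)
Lemma coef_thinning n i y q k : 0 < q -> q < 1 -> (k < n)%N ->
  (thinning_poly n i y q)`_k =
  if k == 0%N then binomial_weight i 0 y
  else \sum_(1 <= l < (minn i k).+1)
    binomial_weight i l y * negbinomial_weight k%:R l%:R q.
Proof.
move=> q0 q1 kn; rewrite coef_sum big_ord_recl coefZ.
under eq_bigr => l _ do rewrite lift0 coefZ coef_success//.
rewrite coef1; case: k kn => [|k] kn /=.
  by rewrite mulr1 big1 ?addr0// => l _; rewrite mulr0.
rewrite mulr0 add0r.
transitivity (\sum_(1 <= l < i.+1) if (l <= k.+1)%N then
    binomial_weight i l y * negbinomial_weight k.+1%:R l%:R q else 0).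
  rewrite big_add1 /= big_mkord; apply: eq_bigr => l _ /=.
  by case: ifP => _; rewrite ?mulr0.
rewrite -big_mkcond /= (big_nat_widen _ (minn i k.+1).+1 i.+1); last first.
  by rewrite ltnS geq_minl.
rewrite big_nat_cond [RHS]big_nat_cond; apply: eq_bigl => l; lia.
Qed.

End Weights.

(** * The two forms of the h-step pgf and its coefficients at 1 *)

Section Transition.
Context {R : realType}.
Implicit Types (a b r q s mu : R).

Lemma NB_pgfE r m s : 0 < r -> 0 < m -> s <= 1 ->
  let q := r / (r + m) in NB_pgf r m s = (q / (1 - (1 - q) * s)) `^ r.
Proof.
move=> r0 m0 s1 q; rewrite /NB_pgf.
have D0 : 0 < 1 + m / r * (1 - s).
  by rewrite ltr_pwDl// mulr_ge0 ?subr_ge0// divr_ge0// ltW.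
rewrite -inv_powR//; congr (_ `^ _); rewrite /q.
have rm : r + m != 0 by rewrite gt_eqF// addr_gt0.
have rn : r != 0 by rewrite gt_eqF.
(* The origin of q: as a polynomial in s, 1 + (m/r)(1 - s) has constant term (r + m)/r = 1/q. *)
have E : 1 - (1 - r / (r + m)) * s = r / (r + m) * (1 + m / r * (1 - s)).
  by field; rewrite rm rn.
by rewrite E [in RHS]invfM mulVKf// mulf_neq0// invr_neq0.
Qed.

Lemma thinning_pgfE a mu r s : 0 < r -> 0 < mu -> a <= 1 -> s <= 1 ->
  let q := r / (r + (1 - a) * mu) in
  thinning_pgf a mu r s = 1 - a * q * ((1 - s) / (1 - (1 - q) * s)).
Proof.
move=> r0 mu0 a1 s1 q; rewrite /thinning_pgf /q; set m := (1 - a) * mu.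
have m0 : 0 <= m by rewrite mulr_ge0 ?subr_ge0// ltW.
have D0 : 0 < 1 + m / r * (1 - s).
  by rewrite ltr_pwDl// mulr_ge0 ?subr_ge0// divr_ge0// ltW.
have rm : r + m != 0 by rewrite gt_eqF// ltr_wpDr.
have rn : r != 0 by rewrite gt_eqF.
have -> : 1 - (1 - r / (r + m)) * s = r / (r + m) * (1 + m / r * (1 - s)).
  by field; rewrite rm rn.
have -> : r^-1 * (1 - a) * mu = m / r by rewrite /m; ring.
set D := 1 + _ in D0 *; have Dn : D != 0 by rewrite gt_eqF.
by field; rewrite rm rn Dn.
Qed.

Lemma coef012_exp (g : {poly R}) i : g`_0 = 1 ->
  [/\ (g ^+ i)`_0 = 1, (g ^+ i)`_1 = i%:R * g`_1 &
      (g ^+ i)`_2 = i%:R * g`_2 + 'C(i, 2)%:R * g`_1 ^+ 2].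
Proof.
move=> g0; elim: i => [|i [h0 h1 h2]].
  by rewrite expr0 !coef1 /= bin0n !mul0r addr0.
rewrite exprS !coefM !big_ord_recr !big_ord0 /= !add0r g0 h0 h1 h2.
by rewrite binS bin1 natrD -natr1; split; ring.
Qed.

(** Agrees through order 2 in u with the conditional pgf at s = 1 - u when b = (1 - a) mu / r. With
    a = 0, i = 0 and b = mu / r it describes the NB marginal instead. *)
Definition transition_poly a b r i : {poly R} :=
  (1 - a *: ('X * negbin_poly 3 1 (- b))) ^+ i * negbin_poly 3 r (- b).

Lemma expansion_transition a b r i : 0 <= b -> 0 < r ->
  expansion 3 (fun u => (1 - a * (u / (1 + b * u))) ^+ i * (1 + b * u) `^ (- r))
    (transition_poly a b r i).
Proof.
move=> b0 r0.
have E x u : 0 < u <= 2^-1 -> (1 - - b * u) `^ x = (1 + b * u) `^ x.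
  by move=> _; rewrite mulNr opprK.
apply: expansionM; last first.
  apply: expansion_ext (@expansion_negbin R 3 r (- b) r0 _); last by lra.
  by move=> s hs; exact: E.
apply: expansionX.
apply: (@expansion_ext _ _ (fun u => (1 : {poly R}).[u] +
    (- a) * ('X.[u] * (1 - - b * u) `^ (- 1)))).
  move=> u hu; rewrite E// powR_inv1; last by nra.
  by rewrite hornerX hornerE mulNr.
rewrite -scaleNr; apply: expansionD; first exact: expansion_horner.
apply: expansionZ; apply: expansionM; first exact: expansion_horner.
by apply: expansion_negbin; lra.
Qed.

Lemma coef_transition a b r i : [/\ (transition_poly a b r i)`_0 = 1,
  (transition_poly a b r i)`_1 = - (i%:R * a + r * b) &
  (transition_poly a b r i)`_2 = i%:R * a * b + 'C(i, 2)%:R * a ^+ 2 +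
    r * (r + 1) / 2 * b ^+ 2 + i%:R * a * r * b].
Proof.
have N x : [/\ (negbin_poly 3 x (- b))`_0 = 1, (negbin_poly 3 x (- b))`_1 = - (x * b)
    & (negbin_poly 3 x (- b))`_2 = x * (x + 1) / 2 * b ^+ 2].
  rewrite !coef_poly /rising /= !big_ord_recr !big_ord0 /= !factS fact0.
  by split; field.
have [n0 n1 n2] := N r; have [m0 m1 m2] := N 1.
set g := 1 - a *: ('X * negbin_poly 3 1 (- b)).
have g0 : g`_0 = 1 by rewrite coefB coef1 coefZ coefXM /= mulr0 subr0.
have g1 : g`_1 = - a by rewrite coefB coef1 coefZ coefXM /= m0 mulr1 sub0r.
have g2 : g`_2 = a * b by rewrite coefB coef1 coefZ coefXM /= m1; ring.
have [h0 h1 h2] := coef012_exp i g0.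
rewrite /transition_poly -/g !coefM !big_ord_recr !big_ord0 /=.
by rewrite h0 h1 h2 n0 n1 n2 g1 g2; split; field.
Qed.

Lemma sqr_nat_bin2 n : (n%:R : R) ^+ 2 = n%:R + 2 * 'C(n, 2)%:R.
Proof.
elim: n => [|n IH]; first by rewrite bin0n mulr0 addr0 expr0n.
by rewrite binS bin1 natrD -natr1 sqrrD IH; ring.
Qed.

End Transition.

(** * Conditional pgf, moments and transition probabilities of the process *)

Theorem proposition4p3 (d : measure_display) (T : measurableType d)
    (R : realType) (P : probability T R) (alpha mu r : R) (h : nat)
    (X : nat -> {RV P >-> nat}) (G : nat -> nat -> {RV P >-> nat})
    (eps : nat -> {RV P >-> nat})
    (alpha01 : 0 < alpha < 1) (mu_gt0 : 0 < mu) (r_gt0 : 0 < r)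
    (h_ge1 : (1 <= h)%N)
    (HX : INAR1 alpha mu r X G eps)
    (Xstat : stationary P X)
    (Xmarg : forall t, NB_distributed P (X t) r mu)
    (epsNB : forall t, NB_distributed P (eps t.+1) r ((1 - alpha) * mu)) :
  let a := alpha ^+ h in
  let q := r / (r + (1 - a) * mu) in
  [/\ forall t, is_cond_pgf P (sigma_rv (X t)) (X (t + h)%N)
        (fun s w => (1 - a * q * ((1 - s) / (1 - (1 - q) * s))) ^+ X t w
                    * (q / (1 - (1 - q) * s)) `^ r),
      forall t, is_cond_expectation P (sigma_rv (X t))
        (fun w => (X (t + h)%N w)%:R)
        (fun w => a * (X t w)%:R + mu * (1 - a)),
      forall t, is_cond_variance P (sigma_rv (X t))
        (fun w => (X (t + h)%N w)%:R)
        (fun w => (2 * mu / r + 1) * a * (1 - a) * (X t w)%:R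
                  + mu * (1 - a) * (1 + (1 - a) * mu / r)) &
      forall t i j : nat,
        cond_prob P (X (t + h)%N @^-1` [set j]) (X t @^-1` [set i])
        = if i == 0%N then negbinomial_weight (j%:R + r) r q
          else binomial_weight i 0 (a * q) * negbinomial_weight (j%:R + r) r q
            + \sum_(1 <= k < j.+1) negbinomial_weight ((j - k)%:R + r) r q *
                (\sum_(1 <= l < (minn i k).+1)
                  binomial_weight i l (a * q)
                  * negbinomial_weight k%:R l%:R q)].
Proof.
move=> a q.
have /andP[alpha0 alpha1] := alpha01.
have a0 : 0 < a by rewrite exprn_gt0.
have a1 : a < 1 by rewrite exprn_ilt1 ?ltW// -lt0n.
have am0 : 0 < (1 - a) * mu by rewrite mulr_gt0// subr_gt0.
have q0 : 0 < q by rewrite divr_gt0// addr_gt0.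
have q1 : q < 1 by rewrite ltr_pdivrMr ?addr_gt0// mul1r ltrDl.
have mX t : measurable_fun setT (X t) by exact: measurable_funPT.
have mA t i : measurable (X t @^-1` [set i]) by exact: measurable_preimage_nat.
pose psi i s := thinning_pgf a mu r s ^+ i * NB_pgf r ((1 - a) * mu) s.
have step t i s : `|s| <= 1 ->
    (\int[P]_(w in X t @^-1` [set i]) (s ^+ X (t + h)%N w)%:E =
     (psi i s)%:E * P (X t @^-1` [set i]))%E.
  exact: (h_step alpha01 mu_gt0 r_gt0 HX epsNB).
have step01 t i s : 0 <= s <= 1 ->
    (\int[P]_(w in X t @^-1` [set i]) (s ^+ X (t + h)%N w)%:E =
     (psi i s)%:E * P (X t @^-1` [set i]))%E.
  by move=> /andP[s0 s1]; apply: step; rewrite ger0_norm.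
have marg01 t s : 0 <= s <= 1 ->
    (\int[P]_w (s ^+ X t w)%:E = (NB_pgf r mu s)%:E * P setT)%E.
  move=> /andP[s0 s1]; rewrite probability_setT mule1.
  by have := Xmarg t s; rewrite /= ger0_norm// unlock => ->.
pose b := (1 - a) * mu / r.
have b0 : 0 < b by rewrite divr_gt0.
have psi_exp i : expansion 3 (fun u => psi i (1 - u)) (transition_poly a b r i).
  apply: expansion_ext (expansion_transition a i (ltW b0) r_gt0) => u _.
  rewrite /psi /thinning_pgf /NB_pgf subKr -/b.
  by have -> : r^-1 * (1 - a) * mu = b by rewrite /b; ring.
have marg_exp : expansion 3 (fun u => NB_pgf r mu (1 - u)) (transition_poly 0 (mu / r) r 0).
  have c0 : 0 <= mu / r by rewrite divr_ge0// ltW.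
  apply: expansion_ext (expansion_transition 0 0 c0 r_gt0) => u _.
  by rewrite expr0 mul1r /NB_pgf subKr.
(* Integrability over the whole space comes from the NB marginal; the conditional identities only
   concern single atoms. *)
have quad t c0 c1 c2 : P.-integrable setT
    (fun w => (c0 + c1 * (X t w)%:R + c2 * 'C(X t w, 2)%:R)%:E).
  have [p0 _ _] := coef_transition 0 (mu / r) r 0.
  exact: (integrable_quadratic (mX t) measurableT (marg01 t) marg_exp p0).
have lin t c0 c1 : P.-integrable setT (fun w => (c1 * (X t w)%:R + c0)%:E).
  have := quad t c0 c1 0; congr (_.-integrable _ _); apply/funext => w.
  by rewrite mul0r addr0 addrC.
have cond_mean t : is_cond_expectation P (sigma_rv (X t))
    (fun w => (X (t + h)%N w)%:R) (fun w => a * (X t w)%:R + mu * (1 - a)).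
  apply: (cond_expectation_fibers (g := fun n => a * n%:R + mu * (1 - a))) => //.
    have := lin (t + h)%N 0 1; congr (_.-integrable _ _); apply/funext => w /=.
    by rewrite mul1r addr0.
  move=> i; have [p0 p1 _] := coef_transition a b r i.
  rewrite (integral_mean (mX (t + h)%N) (mA t i) (step01 t i) (psi_exp i) p0) p1.
  by congr (_%:E * _)%E; rewrite /b; field; rewrite gt_eqF.
split => //.
- move=> t s s1.
  pose g n := (1 - a * q * ((1 - s) / (1 - (1 - q) * s))) ^+ n *
    (q / (1 - (1 - q) * s)) `^ r.
  have gE n : g n = psi n s.
    move: s1; rewrite ler_norml => /andP[s0 s1].
    by rewrite /g /psi (thinning_pgfE r_gt0 mu_gt0 (ltW a1) s1) (NB_pgfE r_gt0 am0 s1).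
  have sn n : `|s ^+ n| <= 1 by rewrite normrX exprn_ile1.
  apply: (cond_expectation_fibers (g := g)) => //.
  + exact: (bounded_comp_integrable P (mX (t + h)%N) measurableT sn).
  + apply: (bounded_comp_integrable (M := `|NB_pgf r ((1 - a) * mu) s|) P (mX t)) => // n.
    rewrite gE normrM ler_piMl// normrX exprn_ile1//.
    by apply: thinning_pgf_norm => //; rewrite a0 a1.
  + by move=> i; rewrite step// gE.
- move=> t; exists (fun w => a * (X t w)%:R + mu * (1 - a)); first exact: cond_mean.
  apply: (cond_expectation_fibers (g := fun n => (2 * mu / r + 1) * a * (1 - a) * n%:R
                  + mu * (1 - a) * (1 + (1 - a) * mu / r))) => //.
    pose m := mu * (1 - a).
    (* With M = a x + m the dominating function is 2 y^2 + 2 M^2 = (y - M)^2 + (y + M)^2, written in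
       the basis 1, n, C(n,2) of [quad]. *)
    apply: (@le_integrable _ _ _ P _ _ _ (fun w =>
        ((0 + 2 * (X (t + h)%N w)%:R + 4 * 'C(X (t + h)%N w, 2)%:R) +
         (2 * m ^+ 2 + (2 * a ^+ 2 + 4 * a * m) * (X t w)%:R
          + 4 * a ^+ 2 * 'C(X t w, 2)%:R))%:E)) => //.
    + apply/measurable_EFinP; apply: measurable_funX; apply: measurable_funB.
        exact: (measurable_comp_nat (fun n => n%:R) (mX (t + h)%N)).
      exact: (measurable_comp_nat (fun n => a * n%:R + m) (mX t)).
    + move=> w _; rewrite /= lee_fin ger0_norm ?sqr_ge0//.
      apply: le_trans (ler_norm _).
      pose x : R := (X t w)%:R; pose y : R := (X (t + h)%N w)%:R.
      have C_sqr n : 'C(n, 2)%:R = (n%:R ^+ 2 - n%:R) / 2 :> R.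
        by rewrite sqr_nat_bin2; field.
      rewrite !C_sqr -subr_ge0 -/x -/y -/m.
      rewrite [leRHS](_ : _ = (y + (a * x + m)) ^+ 2) ?sqr_ge0//.
      by field.
    + by under eq_fun do rewrite EFinD; apply: integrableD => //; exact: quad.
  move=> i; pose m := a * i%:R + mu * (1 - a).
  have [p0 p1 p2] := coef_transition a b r i.
  (* On the atom the conditional mean is the constant [m], so the squared deviation is a quadratic
     in X_{t+h}, again in the basis 1, n, C(n,2). *)
  transitivity (\int[P]_(w in X t @^-1` [set i])
      (m ^+ 2 + (1 - 2 * m) * (X (t + h)%N w)%:R + 2 * 'C(X (t + h)%N w, 2)%:R)%:E)%E.
    apply: eq_integral => w /set_mem /= ->; congr EFin; rewrite -/m sqrrB sqr_nat_bin2.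
    by ring.
  rewrite (integral_quadratic (mX (t + h)%N) (mA t i) (step01 t i) (psi_exp i) p0) p1 p2.
  have -> : 'C(i, 2)%:R = (i%:R ^+ 2 - i%:R) / 2 :> R.
    by rewrite sqr_nat_bin2; field.
  by congr (_%:E * _)%E; rewrite /m /b; field; rewrite gt_eqF.
move=> t i j.
pose A := X t @^-1` [set i].
(* [cond_prob] divides by P(X_t = i), and division by 0 would give 0. Positivity is read off the
   i-th coefficient of the NB marginal pgf. *)
have PA0 : 0 < fine (P A).
  pose qm := r / (r + mu).
  have qm0 : 0 < qm by rewrite divr_gt0// addr_gt0.
  have qm1 : qm < 1 by rewrite ltr_pdivrMr ?addr_gt0// mul1r ltrDl.
  have e1 := expansion_pgf i.+1 (mX t) measurableT (marg01 t).
  have e2 := expansion_negbin_pgf i.+1 r_gt0 qm0 qm1.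
  have e3 : expansion i.+1 (fun s => NB_pgf r mu s * fine (P setT))
      (qm `^ r *: negbin_poly i.+1 r (1 - qm)).
    apply: expansion_ext e2 => s /andP[s0 s1].
    rewrite probability_setT mulr1 (NB_pgfE r_gt0 mu_gt0)//; lra.
  have := expansion_coef_unique e1 e3 (ltnSn i).
  rewrite coefZ !coef_poly ltnSn setTI -/A => ->.
  rewrite mulr_gt0 ?powR_gt0// mulr_gt0 ?exprn_gt0 ?subr_gt0//.
  by rewrite divr_gt0 ?rising_gt0// ltr0n fact_gt0.
have e1 := expansion_pgf j.+1 (mX (t + h)%N) (mA t i) (step01 t i).
have e2 : expansion j.+1 (fun s => psi i s * fine (P A))
    ((fine (P A)) *: (thinning_poly j.+1 i (a * q) q *
      (q `^ r *: negbin_poly j.+1 r (1 - q)))).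
  apply: expansion_ext (expansionZ (fine (P A)) (expansionM
    (expansion_thinning j.+1 i (a * q) q0 q1)
    (expansion_negbin_pgf j.+1 r_gt0 q0 q1))) => s /andP[s0 s1].
  have s1' : s <= 1 by lra.
  by rewrite mulrC /psi (thinning_pgfE r_gt0 mu_gt0 (ltW a1) s1') (NB_pgfE r_gt0 am0 s1').
(* Order j + 1 is just enough to determine the coefficient of s^j: a joint probability on one side,
   a convolution of weights on the other. *)
have := expansion_coef_unique e1 e2 (ltnSn j).
rewrite coef_poly ltnSn coefZ coefM -/A => e.
rewrite /cond_prob setIC e mulrC mulKf; last by rewrite gt_eqF.
have Gk k : (k <= j)%N -> (q `^ r *: negbin_poly j.+1 r (1 - q))`_k =
    negbinomial_weight (k%:R + r) r q.
  by move=> kj; rewrite coefZ coef_poly ltnS kj negbinomial_weightE.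
(* The convolution term k = 0 is the isolated one of the formula, where every individual has zero
   offspring. *)
rewrite big_ord_recl.
under eq_bigr => k _ do rewrite lift0 coef_thinning ?ltnS// Gk ?leq_subr//= mulrC.
rewrite /= subn0 Gk// coef_thinning//=.
(* For i = 0 the inner sums are empty since min(0, k) = 0, and the weight of the isolated term is
   1. *)
case: i A PA0 e1 e2 e => [|i] A PA0 e1 e2 e /=.
  rewrite /binomial_weight bin0 expr0 !mul1r big1 ?addr0// => k _.
  by rewrite min0n big_geq ?mulr0.
congr (_ + _); rewrite big_add1 /= big_mkord.
by apply: eq_bigr => k _.
Qed.
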